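(* Let $n\ge1$, $0<d<n$, $1\le p<\infty$, let $p'$ be the conjugate exponent of $p$, let $\Phi_0(t)=t\log(e+t)$, and let $\mathcal{S}\subset\mathcal{D}$ be a sparse family of dyadic cubes of $\mathbb{R}^n$. Then there is a constant $C>0$, independent of $f$, such that $$\|\mathcal{A}_{\mathcal{S}}f\|_{\mathcal{M}^{p'}_{\Phi_0}(H^d)'}\le C\,\|f\|_{\mathcal{L}^p(H^d)}$$ for all nonnegative $f\in\mathcal{L}^p(H^d)$.
   Context: Dyadic cubes: $\mathcal{D}$ is the class of cubes $Q=2^{-k}(j+[0,1)^n)$, $k\in\mathbb{Z}$, $j\in\mathbb{Z}^n$; $\ell(Q)$ denotes side length. The dyadic Hausdorff content of $E\subset\mathbb{R}^n$ is $H^d(E)=\inf\{\sum_j\ell(Q_j)^d: E\subset\bigcup_jQ_j,\ Q_j\in\mathcal{D}\}$, the infimum over countable coverings. The Choquet integral of $f\ge0$ is $\int_{\mathbb{R}^n}f\,dH^d=\int_0^\infty H^d(\{f>t\})\,dt$. For $0<p<\infty$, $\|f\|_{\mathcal{L}^p(H^d)}=(\int_{\mathbb{R}^n}|f|^p\,dH^d)^{1/p}$ and the Choquet space $\mathcal{L}^p(H^d)$ is the completion, with respect to this functional, of the continuous functions with compact support; $\|f\|_{\mathcal{L}^\infty(H^d)}=\inf\{t>0:H^d(\{|f|>t\})=0\}$. Conjugate exponent: $p'=p/(p-1)$ for $1<p<\infty$ and $p'=\infty$ for $p=1$. A family $\mathcal{S}$ of cubes is $\eta$-sparse, $0<\eta<1$,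 if for every $Q\in\mathcal{S}$ there is a measurable $E_Q\subset Q$ with $|E_Q|\ge\eta|Q|$ and the sets $E_Q$, $Q\in\mathcal{S}$, are pairwise disjoint; sparse means $\eta$-sparse for some $0<\eta<1$. The sparse operator is $\mathcal{A}_{\mathcal{S}}f(x)=\sum_{Q\in\mathcal{S}}\left(\frac1{|Q|}\int_Qf\,dy\right)\mathbf{1}_Q(x)$. For a Young function $\Phi$ and a cube $Q$, $\|f\|_{\Phi;Q}=\inf\{\lambda>0:\frac1{|Q|}\int_Q\Phi(|f(x)|/\lambda)\,dx\le1\}$. The dyadic fractional Orlicz maximal operator is $M_{\alpha,\Phi}f(x)=\sup_{Q\in\mathcal{D}}\ell(Q)^\alpha\|f\|_{\Phi;Q}\mathbf{1}_Q(x)$, $0<\alpha<n$. For $1<q\le\infty$ the Orlicz-Morrey space $\mathcal{M}^q_\Phi(H^d)$ is the set of measurable $f$ with $\|f\|_{\mathcal{M}^q_\Phi(H^d)}=\|M_{n-d,\Phi}f\|_{\mathcal{L}^q(H^d)}<\infty$ (here $\|\cdot\|_{\mathcal{L}^q(H^d)}$ denotes the functional above). For such a space $X$, the associate space $X'$ has norm $\|h\|_{X'}=\sup\{\int_{\mathbb{R}^n}|h(x)g(x)|\,dx:\ \|g\|_X\le1\}$. *)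

(* Defs.v *)
From HB Require Import structures.
From mathcomp Require Import all_boot all_order all_algebra.
From mathcomp Require Import all_classical all_reals all_analysis.

Set Implicit Arguments.
Unset Strict Implicit.
Unset Printing Implicit Defensive.

Import Order.TTheory GRing.Theory Num.Theory.
Import numFieldNormedType.Exports.

Local Open Scope classical_set_scope.
Local Open Scope ring_scope.

Section covering.
Context {R : realType} {T : Type} {I : choiceType}.
Variables (B : I -> set T) (w : I -> R).
Implicit Types (E : set T) (F : set I).
Local Open Scope ereal_scope.

(* Finite and empty families are countable, so they are allowed. *)
Definition covers E : set (set I) :=
  [set F | countable F /\ E `<=` \bigcup_(i in F) B i].

Definition cover_content E : \bar R :=
  ereal_inf [set \esum_(i in F) (w i)%:E | F in covers E].

Hypothesis w_ge0 : forall i, (0 <= w i)%R.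

Let wE_ge0 i : 0 <= (w i)%:E.
Proof. by rewrite lee_fin. Qed.

Lemma cover_content_ge0 E : 0 <= cover_content E.
Proof. by apply: le_ereal_inf_tmp => _ [F _ <-]; exact: esum_ge0. Qed.

Lemma cover_content0 : cover_content set0 = 0.
Proof.
apply/eqP; rewrite eq_le cover_content_ge0 andbT.
apply: ereal_inf_lbound; exists set0; last by rewrite esum_set0.
by split=> //; exact: sub0set.
Qed.

Lemma le_cover_content : {homo cover_content : A E / A `<=` E >-> A <= E}.
Proof.
move=> A E AE; apply: ereal_inf_le_tmp => _ [F [cF EF] <-].
by exists F => //; split => //; exact: subset_trans EF.
Qed.

Let esum_bigcup_le (G : (set I)^nat) :
  \esum_(i in \bigcup_k G k) (w i)%:E <=
  \sum_(k <oo) \esum_(i in G k) (w i)%:E.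
Proof.
rewrite seqDU_bigcup_eq esum_bigcupT//.
rewrite nneseries_esumT; last by move=> k; exact: esum_ge0.
apply: le_esum => k _; rewrite esum_mkcond [leRHS]esum_mkcond.
apply: le_esum => i _; case: ifPn => [|_]; last by case: ifPn.
by rewrite inE => -[Gki _]; rewrite mem_set.
Qed.

Lemma cover_content_sigma_subadditive : sigma_subadditive cover_content.
Proof.
move=> A; have [[i ioo]|] := pselect (exists i, cover_content (A i) = +oo).
  rewrite (eseries_pinfty _ _ ioo) ?leey// => n _.
  by rewrite -ltNye (lt_le_trans _ (cover_content_ge0 _)).
rewrite -forallNE => Aoo.
apply/lee_addgt0Pr => e e0.
rewrite (le_trans _ (epsilon_trick _ _ (ltW e0)))//; last first.
  by move=> n; exact: cover_content_ge0.
have [G PG] : {G : (set I)^nat & forall n, covers (A n) (G n) /\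
    \esum_(i in G n) (w i)%:E <=
    cover_content (A n) + (e / (2 ^ n.+1)%:R)%:E}.
  apply: (@choice _ _ (fun n F => covers (A n) F /\ \esum_(i in F) (w i)%:E <=
    cover_content (A n) + (e / (2 ^ n.+1)%:R)%:E)) => n.
  have en0 : (0 < e / (2 ^ n.+1)%:R)%R by rewrite divr_gt0// ltr0n expn_gt0.
  have fA : cover_content (A n) \is a fin_num.
    by rewrite ge0_fin_numE ?cover_content_ge0// ltey; exact/eqP/Aoo.
  have [_ [F cF <-] Fe] := lb_ereal_inf_adherent en0 fA.
  by exists F; split => //; exact: (ltW Fe).
apply: (@le_trans _ _ (\esum_(i in \bigcup_k G k) (w i)%:E)).
  apply: ereal_inf_lbound; exists (\bigcup_k G k) => //; split.
    by apply: bigcup_countable => // n _; have [[]] := PG n.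
  move=> x [n _ Anx]; have [[_ /(_ x Anx)[i Gi Bix]] _] := PG n.
  by exists i => //; exists n.
apply: le_trans (esum_bigcup_le G) _.
apply: lee_nneseries => [n _ _|n _]; first exact: esum_ge0.
exact: (PG n).2.
Qed.

End covering.

Section lebesgue.
Context {R : realType} {n : nat}.

Definition box (ab : 'rV[R]_n * 'rV[R]_n) : set 'rV[R]_n :=
  [set x | forall i, ab.1 ord0 i <= x ord0 i < ab.2 ord0 i].

Definition box_volume (ab : 'rV[R]_n * 'rV[R]_n) : R :=
  \prod_i Num.max 0 (ab.2 ord0 i - ab.1 ord0 i).

Lemma box_volume_ge0 ab : 0 <= box_volume ab.
Proof. by apply: prodr_ge0 => i _; rewrite le_max lexx. Qed.

Definition lebesgue_outer : set 'rV[R]_n -> \bar R :=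
  cover_content box box_volume.

HB.instance Definition _ := isOuterMeasure.Build R 'rV[R]_n lebesgue_outer
  (cover_content0 box box_volume_ge0)
  (cover_content_ge0 box box_volume_ge0)
  (@le_cover_content _ _ _ box box_volume)
  (cover_content_sigma_subadditive box box_volume_ge0).

End lebesgue.

(* R^n as a measurable space: the measurable sets of [caratheodory_type] are
   the Caratheodory-measurable ones, that is, the Lebesgue measurable sets. *)
Definition Rn (R : realType) (n : nat) : Type :=
  caratheodory_type (@lebesgue_outer R n).

HB.instance Definition _ (R : realType) (n : nat) :=
  Measurable.on (Rn R n).

Definition lebesgue_Rn (R : realType) (n : nat) : set (Rn R n) -> \bar R :=
  lebesgue_outer.

HB.instance Definition _ (R : realType) (n : nat) :=
  isMeasure.Build _ (Rn R n) R (@lebesgue_Rn R n)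
    (caratheodory_measure0 (@lebesgue_outer R n))
    (caratheodory_measure_ge0 (mu := @lebesgue_outer R n))
    (caratheodory_measure_sigma_additive (mu := @lebesgue_outer R n)).

(* [(k, j)] stands for 2^-k (j + [0,1)^n); for n >= 1 distinct indices give
   distinct cubes. *)
Definition dcube (n : nat) : choiceType := (int * 'rV[int]_n)%type.

Section dyadic.
Context {R : realType} {n : nat}.
Implicit Types (Q : dcube n) (S : set (dcube n)) (d t : R).

Definition side Q : R := 2%:R ^ (- Q.1).

Definition cube Q : set 'rV[R]_n :=
  [set x | exists2 y : 'rV[R]_n, (forall i, 0 <= y ord0 i < 1) &
    x = side Q *: (map_mx intr Q.2 + y)].

Definition hausdorff_content d : set 'rV[R]_n -> \bar R :=
  cover_content cube (fun Q => side Q `^ d).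

Local Open Scope ereal_scope.

Definition choquet_integral d (F : 'rV[R]_n -> \bar R) : \bar R :=
  \int[lebesgue_measure]_(t in `]0%R, +oo[)
    hausdorff_content d [set x | t%:E < F x].

(* The functional on functions with values in [-oo, +oo], for exponents in
   (0, +oo]; the value at -oo is irrelevant. *)
Definition choquet_norm d (p : \bar R) (F : 'rV[R]_n -> \bar R) : \bar R :=
  match p with
  | r%:E => choquet_integral d (fun x => `|F x| `^ r) `^ r^-1
  | +oo => ereal_inf [set t%:E | t in
      [set t | (0 < t)%R /\ hausdorff_content d [set x | t%:E < `|F x|] = 0]]
  | -oo => 0
  end.

Definition continuous_compact_support : set ('rV[R]_n -> R) :=
  [set phi | continuous phi /\ compact (closure [set x | phi x != 0%R])].

(* The completion of the continuous functions with compact support, realized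
   as the closure of that class for the functional: as the content is countably
   subadditive, every Cauchy sequence has a subsequence that converges off a set
   of content zero, and its limit is a limit for the functional. *)
Definition choquet_space d (p : R) : set ('rV[R]_n -> R) :=
  [set f | exists2 phi : ('rV[R]_n -> R)^nat,
    (forall k, continuous_compact_support (phi k)) &
    choquet_norm d p%:E (fun x => (f x - phi k x)%:E) @[k --> \oo] --> 0].

Local Notation mu := (@lebesgue_Rn R n).

Definition average Q (F : 'rV[R]_n -> \bar R) : \bar R :=
  (mu (cube Q))^-1 * \int[mu]_(y in cube Q) F y.

Definition eta_sparse (eta : R) S :=
  exists E : dcube n -> set (Rn R n),
    (forall Q, S Q -> [/\ measurable (E Q), E Q `<=` cube Q &
                          eta%:E * mu (cube Q) <= mu (E Q)]) /\
    trivIset S E.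

Definition sparse S := exists2 eta : R, (0 < eta < 1)%R & eta_sparse eta S.

(* [esum] is the sum of a family of nonnegative terms: meant for f >= 0. *)
Definition sparse_operator S (f : 'rV[R]_n -> R) (x : 'rV[R]_n) : \bar R :=
  \esum_(Q in S) (average Q (EFin \o f) * (\1_(cube Q) x)%:E).

Definition luxemburg (Phi : R -> R) Q (f : 'rV[R]_n -> R) : \bar R :=
  ereal_inf [set l%:E | l in
    [set l | (0 < l)%R /\ average Q (fun x => (Phi (`|f x| / l))%:E) <= 1]].

Definition orlicz_maximal (alpha : R) (Phi : R -> R) (f : 'rV[R]_n -> R)
    (x : 'rV[R]_n) : \bar R :=
  ereal_sup [set (side Q `^ alpha)%:E * luxemburg Phi Q f *
                 (\1_(cube Q) x)%:E | Q in [set: dcube n]].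

Definition orlicz_morrey_norm d (q : \bar R) (Phi : R -> R)
    (f : 'rV[R]_n -> R) : \bar R :=
  choquet_norm d q (orlicz_maximal (n%:R - d) Phi f).

Definition orlicz_morrey_space d (q : \bar R) (Phi : R -> R) :
    set ('rV[R]_n -> R) :=
  [set f | measurable_fun [set: Rn R n] (f : Rn R n -> R) /\
           orlicz_morrey_norm d q Phi f < +oo].

Definition associate_norm (X : set ('rV[R]_n -> R))
    (N : ('rV[R]_n -> R) -> \bar R) (h : 'rV[R]_n -> \bar R) : \bar R :=
  ereal_sup [set \int[mu]_x `|h x * (g x)%:E| | g in
    [set g | X g /\ N g <= 1]].

Definition orlicz_morrey_associate_norm d (q : \bar R) (Phi : R -> R) :=
  associate_norm (orlicz_morrey_space d q Phi) (orlicz_morrey_norm d q Phi).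

End dyadic.

Definition Phi0 {R : realType} (t : R) : R := t * ln (expR 1 + t).

(* Main.v *)
Require Import Defs.
From HB Require Import structures.
From mathcomp Require Import all_boot all_order all_algebra.
From mathcomp Require Import all_classical all_reals all_analysis.
From mathcomp Require Import measurable_realfun ring lra zify.

Set Implicit Arguments.
Unset Strict Implicit.
Unset Printing Implicit Defensive.

Import Order.TTheory GRing.Theory Num.Theory.
Import numFieldNormedType.Exports.

Local Open Scope classical_set_scope.
Local Open Scope ring_scope.

(** The sparse operator is self-adjoint, so with [h = A_S |g|] the quantity to
    bound is [\int f h dx].  The maximal function [W = M_{n-d,Phi0} g] controls
    [h] on cubes: for every dyadic [Q] and every [x] in [Q],

      [\int_Q h dx <= K l(Q)^d W(x)]      ([integral_sparse_operator_le]).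

    Cubes of [S] that strictly contain [Q] contribute a geometric series, since
    the mean of [|g|] over [P] is at most [l(P)^{d-n} W(x)]
    ([esum_ancestors_le]).  Cubes [P] of [S] inside [Q] contribute the sum of
    [\int_P |g|], that is [\int_Q |g| N] where [N] counts the cubes over each
    point; sparseness makes [N] exponentially integrable
    ([overlap_exp_integral]), and Young's inequality
    [s t <= s log(e + s) + e^t] turns this into the L log L norm of [g] on [Q]
    ([sparse_esum_integral_le]).

    Hence the weight [v = h / W] satisfies [\int_Q v dx <= K l(Q)^d] for all
    cubes, and by covering [\int_A v dx <= K H^d(A)] for all measurable [A]
    ([integral_le_hausdorff_content]).  So [v dx] is a genuine measure dominated
    by the content, and the layer cake formula gives
    [\int F v dx <= K \int F dH^d] for every measurable [F >= 0]
    ([integral_weight_le_choquet]).  The function [W] is finite off a set of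
    content zero, hence almost everywhere, so that [f h = f W v] almost
    everywhere, and Young's inequality for the exponents [p] and [p'] with
    respect to the measure [v dx] finishes the proof ([hoelder_choquet],
    [hoelder_choquet1]).  No additivity of the Choquet integral is used.

    Two reductions make this work in the generality of the statement.  The
    averages of [f] are integrals of a nonnegative function, defined as suprema
    over simple functions; countably many of them are unchanged when [f] is
    replaced by a suitable measurable minorant ([measurable_minorant]).  And
    the cubes satisfy [|Q| = l(Q)^n |Q_0|] with [Q_0] the unit cube: only the
    dichotomy [|Q_0| = 0], when all integrals vanish, or [0 < |Q_0| < oo]
    enters. *)

(** * Countable sums, layer cake and measurable minorants *)

Section countable_sums.
Context {R : realType} {T : choiceType}.
Local Open Scope ereal_scope.

(** Unordered sums over a countable set reduce to series along one enumeration,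
    chosen before the summand; [None] stands for the skipped indices.  This is
    how monotone convergence for series reaches families indexed by cubes. *)
Lemma esum_series (S : set T) : countable S ->
  exists e : nat -> option T,
    [/\ forall k i, e k = Some i -> S i, forall i, S i -> exists k, e k = Some i &
      forall a : T -> \bar R, (forall i, S i -> 0 <= a i) ->
        \esum_(i in S) a i = \sum_(k <oo) oapp a 0 (e k)].
Proof.
move=> /countable_injP[f injf].
have /choice[e eP] : forall k : nat, exists o : option T,
    if o is Some i then S i /\ f i = k else ~ (exists2 i, S i & f i = k).
  move=> k; have [[i Si fi]|nex] := pselect (exists2 i, S i & f i = k).
    by exists (Some i).
  by exists None.
have ef i : S i -> e (f i) = Some i.
  move=> Si; have := eP (f i); case: (e (f i)) => [j [Sj fji]|[]].
    by congr Some; apply: injf; rewrite ?inE.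
  by exists i.
exists e; split=> [k i ek|i Si|a a0]; first by have := eP k; rewrite ek => -[].
  by exists (f i); exact: ef.
rewrite nneseries_esumT; last first.
  move=> k; case E : (e k) => [i|//] /=.
  by apply: a0; have := eP k; rewrite E => -[].
transitivity (\esum_(i in S) oapp a 0 (e (f i))).
  by apply: eq_esum => i Si; rewrite ef.
rewrite -(@esum_image _ _ _ S f (fun k => oapp a 0 (e k)) injf) esum_mkcond.
apply: eq_esum => k _.
case: ifPn => // /negP kS; have := eP k; case: (e k) => [i [Si fi]|//].
by exfalso; apply: kS; rewrite inE; exists i.
Qed.

Context d {X : measurableType d} (mu : {measure set X -> \bar R}).
Variables (S : set T) (F : T -> X -> \bar R).
Hypotheses (cS : countable S) (mF : forall i, S i -> measurable_fun [set: X] (F i)).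
Hypothesis F0 : forall i x, 0 <= F i x.

Lemma measurable_fun_esum : measurable_fun [set: X] (fun x => \esum_(i in S) F i x).
Proof.
have [e [eS _ eE]] := esum_series cS.
rewrite [X in measurable_fun _ X](_ : _ =
    fun x => \sum_(k <oo) oapp (F ^~ x) 0 (e k)).
  apply: ge0_emeasurable_sum => [k x _ _|k _]; first by case: (e k) => /=.
  by case E : (e k) => [i|] /=; [apply: mF; exact: eS E|exact: measurable_cst].
by apply/funext => x; rewrite eE.
Qed.

Lemma integral_esum :
  \int[mu]_x (\esum_(i in S) F i x) = \esum_(i in S) \int[mu]_x F i x.
Proof.
have [e [eS _ eE]] := esum_series cS.
under eq_integral do rewrite eE//.
rewrite eE; last by move=> i _; exact: integral_ge0.
rewrite integral_nneseries//.
- apply: eq_eseriesr => k _; case: (e k) => [i|] //=.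
  by rewrite integral0_eq.
- by move=> k; case E : (e k) => [i|] /=; [apply: mF; exact: eS E|exact: measurable_cst].
- by move=> k x _; case: (e k) => /=.
Qed.

End countable_sums.

Section countable_cover.
Context {R : realType} {T : choiceType}.
Context d {X : measurableType d} (mu : {measure set X -> \bar R}).
Local Open Scope ereal_scope.

Lemma integral_cover_le (S : set T) (B : T -> set X) (E : set X)
    (v : X -> \bar R) :
    countable S -> (forall i, S i -> measurable (B i)) -> measurable E ->
    E `<=` \bigcup_(i in S) B i ->
    measurable_fun [set: X] v -> (forall x, 0 <= v x) ->
  \int[mu]_(x in E) v x <= \esum_(i in S) \int[mu]_(x in B i) v x.
Proof.
move=> cS mB mE ES mv v0.
have mr (A : set X) : measurable A -> measurable_fun [set: X] (v \_ A).
  by move=> mA; apply/(measurable_restrictT _ _).1 => //; exact: measurable_funTS.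
have r0 (A : set X) x : 0 <= (v \_ A) x by apply: erestrict_ge0.
rewrite integral_mkcond; under eq_esum do rewrite integral_mkcond.
rewrite -integral_esum//; last by move=> i Si; apply: mr; exact: mB.
apply: ge0_le_integral => //; first exact: mr.
  by apply: measurable_fun_esum => // i Si; apply: mr; exact: mB.
move=> x _; rewrite {1}/patch; case: ifPn => [|_]; last exact: esum_ge0.
rewrite inE => /ES[i Si Bix]; apply: esum_ge; exists [set i].
  by split => // _ ->.
by rewrite fsbig_set1 patchE mem_set.
Qed.

End countable_cover.

Section layer_cake.
Context {R : realType}.
Local Open Scope ereal_scope.

Lemma nonincreasing_emeasurable (D : set R) (phi : R -> \bar R) :
  measurable D -> {homo phi : s t / (s <= t)%R >-> t <= s} ->
  measurable_fun D phi.
Proof.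
move=> mD phi_ni; apply: measurable_funTS.
apply: (measurability _ (ErealGenOInfty.measurableE R)).
move=> _ [_ [a ->] <-]; rewrite setTI preimage_itvoy.
apply: is_interval_measurable => s t /= _ at_ r /andP[_ rt].
exact: lt_le_trans at_ (phi_ni _ _ rt).
Qed.

Context d {X : measurableType d} (mu : {sigma_finite_measure set X -> \bar R}).
Local Notation leb := (@lebesgue_measure R).

(** [F v] is the integral over [t > 0] of [v] on the level sets [F > t], so by
    Tonelli a measure [v dmu] that is dominated by a monotone set function [H]
    on measurable sets satisfies the same domination for integrals, the one with
    respect to [H] being taken in the sense of Choquet. *)
Lemma layer_cake_le (H : set X -> \bar R) (C : R) (F v : X -> \bar R) :
    (0 <= C)%R -> (forall A, 0 <= H A) ->
    {homo H : A B / A `<=` B >-> A <= B} ->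
    measurable_fun [set: X] F -> (forall x, 0 <= F x) ->
    measurable_fun [set: X] v -> (forall x, 0 <= v x) ->
    (forall A, measurable A -> \int[mu]_(x in A) v x <= C%:E * H A) ->
  \int[mu]_x (F x * v x) <=
    C%:E * \int[leb]_(t in `]0%R, +oo[) H [set x | t%:E < F x].
Proof.
move=> C0 H0 Hle mF F0 mv v0 vH.
have mH : measurable_fun (`]0%R, +oo[%classic : set R) (fun t => H [set x | t%:E < F x]).
  apply: nonincreasing_emeasurable => // s t st; apply: Hle => x /=.
  by apply: le_lt_trans; rewrite lee_fin.
pose P : set (X * measurableTypeR R) := [set z | 0%:E < z.2%:E < F z.1].
have mP : measurable P.
  have m1 : measurable_fun [set: X * measurableTypeR R] (fun z => F z.1).
    exact: measurableT_comp.
  have m2 : measurable_fun [set: X * measurableTypeR R] (fun z => z.2%:E).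
    exact/measurable_EFinP.
  have := measurableI _ _ (measurable_lte measurableT (measurable_cst 0%:E) m2)
            (measurable_lte measurableT m2 m1).
  rewrite !setTI; congr (measurable _).
  by apply/seteqP; split => z /= => [[a b]|/andP[a b]] //; apply/andP.
pose phi (z : X * measurableTypeR R) := v z.1 * (\1_P z)%:E.
have mphi : measurable_fun [set: X * measurableTypeR R] phi.
  apply: emeasurable_funM; first exact: measurableT_comp.
  exact/measurable_EFinP/measurable_indic.
have phi0 z : 0 <= phi z by rewrite mule_ge0 // lee_fin.
have -> : \int[mu]_x (F x * v x) = \int[mu]_x \int[leb]_t phi (x, t).
  apply: eq_integral => x _.
  pose Px : set (measurableTypeR R) := [set t | P (x, t)].
  have mPx : measurable Px.
    have := measurable_xsection x mP; congr (measurable _).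
    by apply/seteqP; split => t; rewrite /xsection /Px /= inE.
  transitivity (\int[leb]_t (v x * (\1_Px t)%:E)); last first.
    apply: eq_integral => t _; rewrite /phi !indicE.
    by have -> : (t \in Px) = ((x, t) \in P) by apply/idP/idP; rewrite !inE.
  have m1P : measurable_fun [set: measurableTypeR R] (fun t => (\1_Px t : R)%:E).
    exact/measurable_EFinP/measurable_indic.
  rewrite ge0_integralZl//.
  rewrite integral_indic// setIT muleC; congr (_ * _).
  have [Fx|Fx] := boolP (F x \is a fin_num).
    have -> : Px = `]0%R, fine (F x)[%classic.
      apply/seteqP; split => t; rewrite /Px /P /= in_itv /= lte_fin;
      by rewrite -(lte_fin _ (fine _)) fineK.
    rewrite /= lebesgue_measure_itv /= lte_fin sube0 -[LHS](fineK Fx).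
    case: ltP => // Fx0.
    by congr EFin; apply/eqP; rewrite eq_le Fx0 fine_ge0.
  have Fxy : F x = +oo.
    by move: (F0 x) Fx; case: (F x) => // r _ /negP[].
  have -> : Px = `]0%R, +oo[%classic.
    apply/seteqP; split => t; rewrite /Px /P /= in_itv /= lte_fin Fxy ltry.
      by [].
    by [].
  by rewrite /= lebesgue_measure_itv /= ltry Fxy.
rewrite (fubini_tonelli phi)// -ge0_integralZl//.
rewrite [leRHS]integral_mkcond; apply: ge0_le_integral => //.
- by move=> t _; exact: integral_ge0.
- exact: measurable_fun_fubini_tonelli_G.
- apply/(measurable_restrictT _ _).1 => //.
  by apply: emeasurable_funM => //; exact: measurable_cst.
move=> t _; rewrite patchE; case: ifPn => tD; last first.
  rewrite integral0_eq// => x _; rewrite /phi indicE memNset ?mule0//=.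
  move=> /andP[t0 _]; move/negP: tD; apply.
  by rewrite inE /= in_itv /= andbT -lte_fin.
have mA : measurable [set x | t%:E < F x].
  by have := emeasurable_fun_o_infty measurableT mF t%:E; rewrite setTI.
apply: le_trans (vH _ mA); rewrite [leRHS]integral_mkcond.
rewrite le_eqVlt; apply/orP; left; apply/eqP; apply: eq_integral => x _.
rewrite /phi indicE patchE /=; move: tD; rewrite inE /= in_itv /= andbT => t0.
have -> : ((x, t) \in P) = (x \in [set x | t%:E < F x]).
  by apply/idP/idP; rewrite !inE /P /= lte_fin t0.
by case: (_ \in _); rewrite ?mule1 ?mule0.
Qed.

End layer_cake.

Section measurable_minorant.
Context {R : realType} d {X : measurableType d} (mu : {measure set X -> \bar R}).
Context {I : countType} (A : I -> set X).
Hypothesis mA : forall i, measurable (A i).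
Import HBNNSimple.

(** The integral of a nonnegative function that need not be measurable is a
    supremum over simple functions below it.  The minorant is the pointwise
    supremum of countably many such simple functions: for each set [A i] and each
    rational [q] below the integral over [A i], one with integral above [q]. *)
Lemma measurable_minorant (f : X -> R) : (forall x, 0 <= f x) ->
  exists f0 : X -> R, [/\ measurable_fun [set: X] f0,
    forall x, 0 <= f0 x <= f x &
    forall i, (\int[mu]_(x in A i) (f x)%:E <= \int[mu]_(x in A i) (f0 x)%:E)%E].
Proof.
move=> f_ge0.
have /choice[h hP] : forall iq : I * rat, exists h : {nnsfun X >-> R},
    (forall x, ((h x)%:E <= ((EFin \o f) \_ (A iq.1)) x)%E) /\
    (((ratr iq.2)%:E < \int[mu]_(x in A iq.1) (f x)%:E)%E ->
     ((ratr iq.2)%:E < sintegral mu h)%E).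
  move=> [i q] /=; have [qf|qf] := boolP ((ratr q)%:E < \int[mu]_(x in A i) (f x)%:E)%E.
    move: (qf); rewrite ge0_integralE; last by move=> x _; rewrite lee_fin.
    by move=> /ereal_sup_gt[_ [h /= hf <-] qh]; exists h.
  exists nnsfun0; split => // x.
  by rewrite /= patchE; case: ifP => //= _; rewrite lee_fin.
pose g (k : nat) : X -> R := if unpickle k is Some iq then h iq else cst 0.
have gf k x : g k x <= f x.
  rewrite /g; case: (unpickle k) => [iq|]; last exact: f_ge0.
  have := (hP iq).1 x; rewrite patchE; case: ifP => _; first by rewrite lee_fin.
  by rewrite lee_fin => /le_trans; apply.
have mg k : measurable_fun [set: X] (g k).
  by rewrite /g; case: (unpickle k) => [iq|]; [exact: measurable_funP|exact: measurable_cst].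
have ubg x : has_ubound (range (g ^~ x)) by exists (f x) => _ [k _ <-].
pose f0 x := sups (g ^~ x) 0.
have mf0 : measurable_fun [set: X] f0 by apply: measurable_fun_sups.
have gf0 k x : g k x <= f0 x.
  apply: ub_le_sup; first by exists (f x) => _ [j _ <-].
  by exists k.
exists f0; split=> // [x|i].
  apply/andP; split.
    apply: le_trans (gf0 (0%N) x).
    by rewrite /g; case: (unpickle _) => [iq|//]; exact: fun_ge0.
  by apply: ge_sup => [|_ [k _ <-]]; [exists (g 0%N x), 0%N|exact: gf].
have f00 x : 0 <= f0 x.
  apply: le_trans (gf0 (0%N) x).
  by rewrite /g; case: (unpickle _) => [iq|//]; exact: fun_ge0.
rewrite leNgt; apply/negP => lt_f.
have [q /andP[q0 qf]] : exists q : rat, ((\int[mu]_(x in A i) (f0 x)%:E <= (ratr q)%:E) &&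
    ((ratr q)%:E < \int[mu]_(x in A i) (f x)%:E))%E.
  move: lt_f; have : (0 <= \int[mu]_(x in A i) (f0 x)%:E)%E.
    by apply: integral_ge0 => x _; rewrite lee_fin.
  case: (\int[mu]_(x in A i) (f0 x)%:E)%E => [a _|_|//]; last by rewrite ltNge leey.
  case: (\int[mu]_(x in A i) (f x)%:E)%E => [b ab|_|].
  - have [q] := rat_in_itvoo ab; rewrite in_itv /= => /andP[aq qb].
    by exists q; rewrite lee_fin ltW//= lte_fin.
  - have a1 : a < a + 1 by rewrite ltrDl.
    have [q] := rat_in_itvoo a1; rewrite in_itv /= => /andP[aq _].
    by exists q; rewrite lee_fin ltW//= ltry.
  - by rewrite ltNge leNye.
have := (hP (i, q)).2 qf; rewrite ltNge => /negP; apply.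
apply: le_trans q0; rewrite -integralT_nnsfun [leRHS]integral_mkcond.
apply: ge0_le_integral => //.
- by move=> x _; rewrite lee_fin fun_ge0.
- exact/measurable_EFinP.
- apply/(measurable_restrictT _ _).1 => //.
  by apply/measurable_EFinP; exact: measurable_funTS.
move=> x _; rewrite patchE; case: ifPn => xA.
  have := gf0 (pickle (i, q)) x; by rewrite /g pickleK lee_fin.
have := (hP (i, q)).1 x; by rewrite patchE /= (negbTE xA).
Qed.
End measurable_minorant.

(** * Lebesgue outer measure of boxes and cubes *)

Section outer_cover.
Context {R : realType} {X : Type} {T : choiceType}.
Local Open Scope ereal_scope.

Lemma outer_measure_cover_le (mu : {outer_measure set X -> \bar R}) (S : set T)
    (B : T -> set X) (E : set X) : countable S -> E `<=` \bigcup_(i in S) B i ->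
  mu E <= \esum_(i in S) mu (B i).
Proof.
move=> cS ES; have [e [eS Se eE]] := @esum_series R _ _ cS.
rewrite eE; last by move=> i _; exact: outer_measure_ge0.
have -> : \sum_(k <oo) oapp (mu \o B) 0 (e k) = \sum_(k <oo) mu (oapp B set0 (e k)).
  by apply: eq_eseriesr => k _; case: (e k) => //=; rewrite outer_measure0.
apply: le_trans (outer_measure_sigma_subadditive mu _).
apply: le_outer_measure => x /ES[i Si Bix].
by have [k ek] := Se i Si; exists k => //; rewrite ek.
Qed.

End outer_cover.

Section boxes.
Context {R : realType} {n : nat}.
Local Notation mu := (@lebesgue_outer R n).
Implicit Types (ab : 'rV[R]_n * 'rV[R]_n) (t : R) (i : 'I_n).

Lemma lebesgue_outer_box ab : (mu (box ab) <= (box_volume ab)%:E)%E.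
Proof.
apply: ereal_inf_lbound; exists [set ab]; first by split=> // x; exists ab.
by rewrite esum_set1 // lee_fin box_volume_ge0.
Qed.

Definition halfspace i t : set 'rV[R]_n := [set x | x ord0 i < t].

Lemma boxI_halfspace ab i t : exists cd,
  [/\ box ab `&` halfspace i t = box cd.1,
      box ab `&` ~` halfspace i t = box cd.2 &
      box_volume cd.1 + box_volume cd.2 = box_volume ab].
Proof.
pose b' := \row_j (if j == i then Num.min (ab.2 ord0 j) t else ab.2 ord0 j).
pose a' := \row_j (if j == i then Num.max (ab.1 ord0 j) t else ab.1 ord0 j).
exists ((ab.1, b'), (a', ab.2)); split.
- apply/seteqP; split => x /=.
  - move=> [abx xt] j; rewrite mxE; have /andP[-> xb] := abx j.
    by case: eqP => [ji|//]; rewrite lt_min xb /= ji.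
  - move=> abx; split => [j|].
      have /andP[-> /=] := abx j; rewrite mxE; case: ifP => // _.
      by rewrite lt_min => /andP[].
    by have /andP[_] := abx i; rewrite mxE eqxx lt_min => /andP[].
- apply/seteqP; split => x /=.
  - move=> [abx xt] j; rewrite mxE; have /andP[ax ->] := abx j.
    rewrite andbT; case: eqP => [ji|]//=; rewrite ge_max ax/= ji leNgt.
    by apply/negP.
  - move=> abx; split => [j|].
      have /andP[+ ->] := abx j; rewrite mxE; case: ifP => [_|_ ->]//.
      by rewrite ge_max => /andP[->].
    have /andP[+ _] := abx i; rewrite mxE eqxx ge_max => /andP[_ tx] /= xt.
    by move: tx; rewrite leNgt => /negP.
rewrite /box_volume (bigD1 i)//= [X in _ + X](bigD1 i)//= [RHS](bigD1 i)//=.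
rewrite !mxE eqxx.
rewrite [X in _ * X + _](eq_bigr (fun j => Num.max 0 (ab.2 ord0 j - ab.1 ord0 j)));
  last by move=> j /negPf ji; rewrite mxE ji.
rewrite [X in _ + _ * X](eq_bigr (fun j => Num.max 0 (ab.2 ord0 j - ab.1 ord0 j)));
  last by move=> j /negPf ji; rewrite mxE ji.
rewrite -mulrDl; congr (_ * _).
move: (ab.1 ord0 i) (ab.2 ord0 i) => a b.
rewrite !maxEle !minEle; do ![case: ifP]; lra.
Qed.

(** Cutting every box of a cover of [E] by the hyperplane gives covers of both
    parts of [E] with the same total volume, which is the condition of
    Caratheodory. *)
Lemma measurable_halfspace i t : measurable (halfspace i t : set (Rn R n)).
Proof.
apply: le_caratheodory_measurable => E.
apply: le_ereal_inf_tmp => _ [F [cF EF] <-].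
have /choice[c cP] := fun ab => boxI_halfspace ab i t.
have cover (D : set 'rV[R]_n) (g : _ -> 'rV[R]_n * 'rV[R]_n) :
    (forall ab, box ab `&` D = box (g ab)) ->
    (mu (E `&` D) <= \esum_(ab in F) (box_volume (g ab))%:E)%E.
  move=> Dg; apply: (@le_trans _ _ (\esum_(ab in F) mu (box (g ab))))%E.
    apply: outer_measure_cover_le => // x [/EF[ab Fab abx] Dx].
    by exists ab => //; rewrite -Dg.
  by apply: le_esum => ab _; exact: lebesgue_outer_box.
apply: (le_trans (leeD (cover _ (fst \o c) _) (cover _ (snd \o c) _))).
- by move=> ab; have [] := cP ab.
- by move=> ab; have [] := cP ab.
rewrite -esumD; try by move=> ab _; rewrite lee_fin box_volume_ge0.
apply: le_esum => ab _; have [_ _ <-] := cP ab.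
by rewrite EFinD.
Qed.

Lemma measurable_box ab : measurable (box ab : set (Rn R n)).
Proof.
have -> : box ab = \bigcap_(i in [set: 'I_n])
    (~` halfspace i (ab.1 ord0 i) `&` halfspace i (ab.2 ord0 i)).
  apply/seteqP; split => x abx i => [_|].
    by have /andP[ax xb] := abx i; split => //=; apply/negP; rewrite -leNgt.
  by have [/= /negP] := abx i I; rewrite -leNgt => -> ->.
apply: (@fin_bigcap_measurable _ (Rn R n)) => // i _.
apply: (@measurableI _ (Rn R n)); last exact: measurable_halfspace.
exact/(@measurableC _ (Rn R n))/measurable_halfspace.
Qed.

End boxes.

Section esum_scale.
Context {R : realType} {T : choiceType}.
Local Open Scope ereal_scope.

Lemma esumZl (S : set T) (a : T -> \bar R) (r : R) : countable S ->
  (0 <= r)%R -> (forall i, 0 <= a i) ->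
  \esum_(i in S) (r%:E * a i) = r%:E * \esum_(i in S) a i.
Proof.
move=> cS r0 a0; have [e [_ _ eE]] := @esum_series R _ _ cS.
rewrite !eE// => [|i _]; last by rewrite mule_ge0.
rewrite -nneseriesZl; last by move=> k _; case: (e k).
by apply: eq_eseriesr => k _; case: (e k) => //=; rewrite mule0.
Qed.
End esum_scale.

Section scaling.
Context {R : realType} {n : nat}.
Local Notation mu := (@lebesgue_outer R n).
Implicit Types (u : 'rV[R]_n) (s : R) (E : set 'rV[R]_n) (Q : dcube n).

Lemma lebesgue_outer_scale_le s u E : 0 < s ->
  (mu [set s *: (u + y) | y in E] <= (s ^+ n)%:E * mu E)%E.
Proof.
move=> s0; have sn0 : 0 < s ^+ n by rewrite exprn_gt0.
rewrite -lee_pdivrMl//; apply: le_ereal_inf_tmp => _ [F [cF EF] <-].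
rewrite lee_pdivrMl// -esumZl//; last 2 first.
- exact: ltW.
- by move=> ab; rewrite lee_fin box_volume_ge0.
pose g (ab : 'rV[R]_n * 'rV[R]_n) := (s *: (u + ab.1), s *: (u + ab.2)).
apply: (@le_trans _ _ (\esum_(ab in F) mu (box (g ab))))%E.
  apply: outer_measure_cover_le => // _ [y /EF[ab Fab aby] <-].
  by exists ab => // i; rewrite !mxE ler_pM2l// ltr_pM2l// lerD2l ltrD2l.
apply: le_esum => ab _; apply: le_trans (lebesgue_outer_box _) _.
rewrite -EFinM lee_fin /box_volume (_ : s ^+ n = \prod_(i < n) s); last first.
  by rewrite prodr_const card_ord.
rewrite -big_split/=; apply: ler_prod => i _.
rewrite le_max lexx /= !mxE -mulrBr opprD addrACA subrr add0r.
by rewrite maxr_pMr ?mulr0 // ltW.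
Qed.

Definition unit_cube : set 'rV[R]_n := box (0, const_mx 1).

Lemma unit_cubeE : unit_cube = [set y : 'rV[R]_n | forall i, 0 <= y ord0 i < 1].
Proof. by apply/seteqP; split => y + i => /(_ i); rewrite !mxE. Qed.

Lemma cube_image Q :
  cube Q = [set side Q *: (map_mx intr Q.2 + y) | y in unit_cube].
Proof.
rewrite unit_cubeE; apply/seteqP; split => x [y y01 xy]; exists y => //.
Qed.

Lemma side_gt0 Q : 0 < side Q :> R.
Proof. by rewrite exprz_gt0. Qed.

(** Scaling gives one inequality; the inverse scaling gives the other.  So the
    measure of the cubes is known up to the measure of the unit cube. *)
Lemma lebesgue_outer_cube Q : mu (cube Q) = ((side Q ^+ n)%:E * mu unit_cube)%E.
Proof.
apply/eqP; rewrite eq_le cube_image lebesgue_outer_scale_le ?side_gt0//=.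
rewrite -lee_pdivlMl ?exprn_gt0 ?side_gt0// -exprVn.
set A := [set _ | _ in _].
apply: le_trans (lebesgue_outer_scale_le (- (side Q *: map_mx intr Q.2)) A _);
  last by rewrite invr_gt0 side_gt0.
apply: le_outer_measure => y yU; exists (side Q *: (map_mx intr Q.2 + y)).
  by exists y.
rewrite [side Q *: (_ + y)]scalerDr addKr scalerA mulVf ?scale1r//.
by rewrite gt_eqF// side_gt0.
Qed.

Lemma lebesgue_outer_unit_cube_lty : (mu unit_cube < +oo)%E.
Proof. by apply: le_lt_trans (lebesgue_outer_box _) _; rewrite ltry. Qed.

Lemma cube_box Q : cube Q =
  box (side Q *: map_mx intr Q.2, side Q *: (map_mx intr Q.2 + const_mx 1)) :> set 'rV[R]_n.
Proof.
apply/seteqP; split => [x [y y01 ->] i /=|x xQ].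
  by rewrite !mxE ler_pM2l ?ltr_pM2l ?side_gt0// lerDl ltrD2l.
exists ((side Q)^-1 *: x - map_mx intr Q.2) => [i|]; last first.
  by rewrite addrC subrK scalerA divff ?scale1r// gt_eqF// side_gt0.
have := xQ i; rewrite !mxE /= subr_ge0 ltrBlDl.
by rewrite -ler_pdivlMl ?side_gt0// -[X in _ && X]ltr_pdivrMl ?side_gt0.
Qed.

Lemma measurable_cube Q : measurable (cube Q : set (Rn R n)).
Proof. by rewrite cube_box; exact: measurable_box. Qed.

End scaling.

(** * The dyadic grid *)

Section dyadic_grid.
Context {R : realType} {n : nat}.
Implicit Types (P Q : dcube n) (x y : 'rV[R]_n) (k l : int).

(** In coordinates a dyadic cube is a fibre of the rounded dilation, which is
    why the cubes of one level partition the space and the levels are nested. *)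
Lemma cubeP Q x :
  cube Q x <-> forall i, Num.floor (2%:R ^ Q.1 * x ord0 i) = Q.2 ord0 i.
Proof.
have sV : 2%:R ^ Q.1 = (side Q)^-1 :> R by rewrite /side invr_expz opprK.
rewrite cube_box; split => [xQ i|xQ i].
  apply: floor_def; have := xQ i; rewrite /= !mxE sV intrD.
  by rewrite ler_pdivlMl ?ltr_pdivrMl ?side_gt0.
have /andP[] := floor_itv (2%:R ^ Q.1 * x ord0 i); rewrite xQ sV intrD.
by rewrite /= !mxE -ler_pdivlMl ?side_gt0// -ltr_pdivrMl ?side_gt0// => -> ->.
Qed.

(** An integer [j] is at most [2^k a] iff [j 2^(l-k)] is at most [2^l a], so the
    finer floor determines the coarser one. *)
Lemma floor_coarser k l (a b : R) : k <= l ->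
  Num.floor (2%:R ^ l * a) = Num.floor (2%:R ^ l * b) ->
  Num.floor (2%:R ^ k * a) = Num.floor (2%:R ^ k * b).
Proof.
move=> kl ab; have [m lkm] : exists m : nat, l = k + m%:Z.
  by exists `|l - k|%N; rewrite gez0_abs ?subr_ge0// [RHS]addrC subrK.
have le_floor (j : int) (c : R) : (j <= Num.floor (2%:R ^ k * c)) =
    (j * 2 ^+ m <= Num.floor (2%:R ^ l * c)).
  rewrite !floor_ge_int lkm intrM rmorphXn/= expfzDr ?pnatr_eq0// -exprnP mulrAC.
  by rewrite ler_pM2r ?exprn_gt0.
by apply/eqP; rewrite eq_le [X in X && _]le_floor -ab -le_floor lexx le_floor ab -le_floor /=.
Qed.

Definition cube_at k x : dcube n := (k, \row_i Num.floor (2%:R ^ k * x ord0 i)).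

Lemma cube_at_mem k x : cube (cube_at k x) x.
Proof. by apply/cubeP => i; rewrite mxE. Qed.

Lemma cube_at_uniq Q x : cube Q x -> Q = cube_at Q.1 x.
Proof.
move=> /cubeP xQ; rewrite [LHS]surjective_pairing; congr pair.
by apply/rowP => i; rewrite mxE xQ.
Qed.

Lemma cube_nested P Q x : cube P x -> cube Q x -> P.1 <= Q.1 ->
  cube Q `<=` (cube P : set 'rV[R]_n).
Proof.
move=> /cubeP xP /cubeP xQ PQ y /cubeP yQ; apply/cubeP => i.
by rewrite -xP; apply: floor_coarser PQ _; rewrite xQ yQ.
Qed.

Lemma countable_dcube (S : set (dcube n)) : countable S.
Proof. exact: (@countableP (int * 'rV[int]_n)%type). Qed.

End dyadic_grid.

Section sigma_finite.
Context {R : realType} {n : nat}.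
Local Notation mu := (@lebesgue_Rn R n).

Lemma lebesgue_cube_lty (Q : dcube n) : (mu (cube Q) < +oo)%E.
Proof.
rewrite [mu _]lebesgue_outer_cube lte_mul_pinfty//.
- by rewrite lee_fin exprn_ge0// ltW// side_gt0.
- exact: lebesgue_outer_unit_cube_lty.
Qed.

(** Tonelli's theorem, behind [layer_cake_le], asks for this. *)
Lemma sigma_finite_lebesgue_Rn : sigma_finite [set: Rn R n] mu.
Proof.
exists (fun k => oapp (fun Q : (int * 'rV[int]_n)%type => cube Q) set0 (unpickle k)).
  apply/seteqP; split => // x _.
  by exists (pickle (cube_at 0 x)) => //; rewrite pickleK; exact: cube_at_mem.
move=> k; case: (unpickle k) => [Q|] /=.
  by split; [exact: measurable_cube|exact: lebesgue_cube_lty].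
by rewrite measure0; split.
Qed.

HB.instance Definition _ :=
  Measure_isSigmaFinite.Build _ (Rn R n) R mu sigma_finite_lebesgue_Rn.

End sigma_finite.

(** * Exponential integrability of the overlap of a sparse family *)

Section sparse.
Context {R : realType} {n : nat}.
Local Notation mu := (@lebesgue_Rn R n).
Variables (S : set (dcube n)) (eta : R) (E : dcube n -> set (Rn R n)).
Hypotheses (eta0 : 0 < eta) (eta1 : eta < 1).
Hypothesis SE : forall Q, S Q -> [/\ measurable (E Q), E Q `<=` cube Q &
  (eta%:E * mu (cube Q) <= mu (E Q))%E].
Hypothesis tE : trivIset S E.
Implicit Types (F : seq (dcube n)) (P Q : dcube n).

Lemma sparse_packing F Q : uniq F -> (forall P, P \in F -> S P) ->
  (forall P, P \in F -> cube P `<=` (cube Q : set 'rV[R]_n)) ->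
  (\sum_(P <- F) mu (E P) <= mu (cube Q))%E.
Proof.
move=> uF FS FQ; rewrite fsbig_seq// -measure_fin_bigcup//.
- apply: (@le_outer_measure _ _ (@lebesgue_outer R n)) => x [P /= PF EPx].
  by apply: (FQ _ PF); have [_ + _] := SE (FS _ PF); apply.
- exact: sub_trivIset tE.
- by move=> P /= /FS /SE[].
Qed.

Definition overlap F (x : 'rV[R]_n) : R := \sum_(P <- F) \1_(cube P) x.

Lemma measurable_overlap F : measurable_fun [set: Rn R n] (overlap F : Rn R n -> R).
Proof. by apply: measurable_sum => P; apply/measurable_indic/measurable_cube. Qed.

Lemma overlap_ge0 F x : 0 <= overlap F x.
Proof. by apply: sumr_ge0. Qed.

Let theta : R := eta / 4.

Lemma measurable_expR_overlap F (D : set (Rn R n)) :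
  measurable_fun D (fun x : Rn R n => (expR (theta * overlap F x))%:E).
Proof.
apply: measurable_funTS; apply/measurable_EFinP.
apply: (measurableT_comp (@measurable_expR R)).
apply: measurable_funM; first exact: measurable_cst.
exact: measurable_overlap.
Qed.

(** Adding to [F] a cube [P] at least as large as all of them changes the
    exponential only on [P], and over [P] only the cubes of [F] inside [P] count,
    by nestedness. *)
Lemma overlap_step F P x : {in F, forall P', P.1 <= P'.1} ->
  expR (theta * overlap (P :: F) x) = expR (theta * overlap F x) +
    (expR theta - 1) * (\1_(cube P) x *
      expR (theta * overlap [seq P' <- F | `[< cube P' `<=` (cube P : set 'rV[R]_n) >]] x)).
Proof.
move=> FP; rewrite {1}/overlap big_cons mulrDr expRD -/(overlap F x) indicE.
have [|xP] := boolP (x \in cube P); last by rewrite mulr0 expR0 mul1r mul0r mulr0 addr0.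
rewrite inE mulr1 mul1r => xP.
have -> : overlap [seq P' <- F | `[< cube P' `<=` (cube P : set 'rV[R]_n) >]] x = overlap F x.
  rewrite /overlap big_filter big_mkcond /=; apply: eq_big_seq => P' P'F.
  case: ifPn => // /asboolPn P'P; rewrite indicE memNset// => xP'.
  by apply: P'P; exact: cube_nested xP xP' (FP _ P'F).
by rewrite mulrBl mul1r addrC subrK.
Qed.

Lemma expR_theta_le : expR theta - 1 <= eta / 2.
Proof.
have theta0 : 0 < theta by rewrite divr_gt0.
have theta1 : theta < 1 / 4 by rewrite ltr_pM2r // invr_gt0.
have theta2 : 0 < 1 - theta by lra.
have : 1 - theta <= (expR theta)^-1 by rewrite -expRN; exact: expR_ge1Dx.
rewrite -[leLHS]invrK lef_pV2 ?posrE ?expR_gt0 ?invr_gt0//.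
move=> /le_trans le_e; rewrite lerBlDl; apply: le_e.
rewrite -[leLHS]mul1r ler_pdivrMr//.
have : 0 <= eta * (1 - eta) by rewrite mulr_ge0 ?subr_ge0 // ltW.
rewrite /theta => h; nra.
Qed.

(** Induction on [F], the largest cube [P] being added last.  By [overlap_step]
    the increment is [e^theta - 1] times the integral over [P] of the exponential
    for the cubes inside [P]; the induction hypothesis on [P] bounds that integral
    by [2 |P|], the sets [E P'] being disjoint parts of [P].  The exponent
    [theta = eta / 4] makes the increment at most [eta |P| <= |E P|]. *)
Lemma overlap_exp_integral F Q : sorted (fun P P' : dcube n => P.1 <= P'.1) F ->
  uniq F -> (forall P, P \in F -> S P) ->
  (forall P, P \in F -> cube P `<=` (cube Q : set 'rV[R]_n)) ->
  (\int[mu]_(x in cube Q) (expR (theta * overlap F x))%:E <=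
   mu (cube Q) + \sum_(P <- F) mu (E P))%E.
Proof.
have [m] := ubnP (size F); elim: m F Q => // m IH [|P F] Q /= Fm sF uF FS FQ.
  under eq_integral do rewrite /overlap big_nil mulr0 expR0.
  by rewrite integral_cst ?mul1e ?big_nil ?adde0//; exact: measurable_cube.
have FP : {in F, forall P', P.1 <= P'.1}.
  by apply/allP; apply: order_path_min sF => P1 P2 P3; exact: le_trans.
have {}sF := path_sorted sF; move: uF => /= /andP[PF uF].
have SF P' : P' \in F -> S P' by move=> P'F; apply: FS; rewrite inE P'F orbT.
pose G := [seq P' <- F | `[< cube P' `<=` (cube P : set 'rV[R]_n) >]].
have mQ := @measurable_cube R n Q; have mP := @measurable_cube R n P.
under eq_integral do rewrite overlap_step// EFinD EFinM -/G.
have SP : S P by apply: FS; rewrite mem_head.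
have c0 : (0 <= (expR theta - 1)%:E)%E.
  by rewrite lee_fin subr_ge0 -expR0 ler_expR ltW// divr_gt0.
pose e1 (x : Rn R n) : \bar R := (expR (theta * overlap F x))%:E.
pose e2 (x : Rn R n) : \bar R := (\1_(cube P) x * expR (theta * overlap G x))%:E.
have me1 : measurable_fun (cube Q : set (Rn R n)) e1 by exact: measurable_expR_overlap.
have me2 : measurable_fun (cube Q : set (Rn R n)) e2.
  apply/measurable_EFinP; apply: measurable_funM; first exact: measurable_indic.
  exact/measurable_EFinP/measurable_expR_overlap.
have e1_ge0 x : (0 <= e1 x)%E by rewrite lee_fin expR_ge0.
have e2_ge0 x : (0 <= e2 x)%E by rewrite lee_fin mulr_ge0 ?expR_ge0.
have me3 : measurable_fun (cube Q : set (Rn R n)) (fun x => ((expR theta - 1)%:E * e2 x)%E).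
  by apply: emeasurable_funM; [exact: measurable_cst|exact: me2].
have e3_ge0 x : (0 <= (expR theta - 1)%:E * e2 x)%E by rewrite mule_ge0.
have -> : (\int[mu]_(x in cube Q) (e1 x + (expR theta - 1)%:E * e2 x) =
    \int[mu]_(x in cube Q) e1 x + \int[mu]_(x in cube Q) ((expR theta - 1)%:E * e2 x))%E.
  by apply: ge0_integralD => [//|x _|//|x _|//]; [exact: e1_ge0|exact: e3_ge0].
have -> : (\int[mu]_(x in cube Q) ((expR theta - 1)%:E * e2 x) =
    (expR theta - 1)%:E * \int[mu]_(x in cube Q) e2 x)%E.
  by apply: ge0_integralZl => // x _; exact: e2_ge0.
have I1 : (\int[mu]_(x in cube Q) e1 x <= mu (cube Q) + \sum_(P' <- F) mu (E P'))%E.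
  by apply: IH => // P' P'F; apply: FQ; rewrite inE P'F orbT.
have I2 : (\int[mu]_(x in cube Q) e2 x <= mu (cube P) + mu (cube P))%E.
  have -> : (\int[mu]_(x in cube Q) e2 x =
      \int[mu]_(x in cube P) (expR (theta * overlap G x))%:E)%E.
    have -> : cube P = cube Q `&` cube P :> set (Rn R n).
      by rewrite setIC setIidl //; apply: FQ; rewrite mem_head.
    rewrite [RHS]integral_mkcondr; apply: eq_integral => x _.
    rewrite patchE /e2 indicE; case: (x \in cube P); first by rewrite mul1r.
    by rewrite mul0r.
  have uG : uniq G by rewrite filter_uniq.
  have SG P' : P' \in G -> S P' by rewrite mem_filter => /andP[_]; exact: SF.
  have GP P' : P' \in G -> cube P' `<=` (cube P : set 'rV[R]_n).
    by rewrite mem_filter => /andP[/asboolP].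
  apply: (le_trans (IH G P _ _ uG SG GP)).
  - by move: Fm; rewrite ltnS; apply: leq_ltn_trans; rewrite size_filter count_size.
  - by apply: sorted_filter => // P1 P2 P3; exact: le_trans.
  - by rewrite leeD2l// sparse_packing.
rewrite big_cons addeCA [leRHS]addeC; apply: leeD => //.
have [_ _] := SE SP; apply: le_trans.
apply: le_trans (lee_wpmul2l c0 I2) _.
have : (0 <= mu (cube P))%E by exact: measure_ge0.
have := @lebesgue_cube_lty R n P; case: (mu (cube P)) => [r _|//|//]; rewrite lee_fin => r0.
rewrite -EFinD -!EFinM lee_fin.
have := ler_wpM2r r0 expR_theta_le; lra.
Qed.

End sparse.

(** * The L log L estimate inside a cube *)

Section young.
Context {R : realType}.
Implicit Types s t : R.

Lemma Phi0_ge_id s : 0 <= s -> s <= Phi0 s.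
Proof.
move=> s0; rewrite /Phi0 ler_peMr// -[leLHS](@expRK R) ler_ln ?posrE ?expR_gt0//.
  by rewrite lerDl.
by rewrite ltr_wpDr ?expR_gt0.
Qed.

Lemma Phi0_ge0 s : 0 <= s -> 0 <= Phi0 s.
Proof. by move=> s0; apply: le_trans s0 (Phi0_ge_id s0). Qed.

Lemma measurable_Phi0 : measurable_fun [set: R] (@Phi0 R).
Proof.
apply: measurable_funM => //; apply: (measurableT_comp (@measurable_ln R)).
exact: measurable_funD.
Qed.

(** Legendre duality between [s log s - s] and [e^t], in the form
    [1 + u <= e^u] at [u = t - ln s]. *)
Lemma young_Phi0 s t : 0 <= s -> s * t <= Phi0 s + expR t.
Proof.
rewrite le_eqVlt => /predU1P[<-|s0]; first by rewrite /Phi0 !mul0r add0r expR_ge0.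
have ln_s : s * ln s <= Phi0 s.
  by rewrite /Phi0 ler_pM2l// ler_ln ?posrE ?lerDr ?expR_ge0// ltr_wpDl ?expR_ge0.
have := expR_ge1Dx (t - ln s); rewrite expRB lnK ?posrE// ler_pdivlMr//.
nra.
Qed.

End young.

Section orlicz.
Context {R : realType} {n : nat}.
Local Notation mu := (@lebesgue_Rn R n).
Hypothesis unit_cube_gt0 : (0 < mu (@unit_cube R n))%E.
Implicit Types (P Q : dcube n) (g : 'rV[R]_n -> R).

Lemma cube_measure Q : exists2 m : R, 0 < m & mu (cube Q) = m%:E.
Proof.
have := @lebesgue_cube_lty R n Q; rewrite [mu (cube Q)]lebesgue_outer_cube.
move: unit_cube_gt0; rewrite /lebesgue_Rn.
have := @lebesgue_outer_unit_cube_lty R n.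
case: (lebesgue_outer _) => [c _|//|//]; rewrite lte_fin => c0 _.
by exists (side Q ^+ n * c); rewrite ?EFinM// mulr_gt0 ?exprn_gt0 ?side_gt0.
Qed.

Lemma average_le Q (f : 'rV[R]_n -> \bar R) (r : R) :
  (average Q f <= r%:E)%E = (\int[mu]_(x in cube Q) f x <= r%:E * mu (cube Q))%E.
Proof.
rewrite /average; have [m m0 ->] := cube_measure Q.
by rewrite inver gt_eqF// lee_pdivrMl// muleC.
Qed.

Lemma average_mul_measure Q (f : 'rV[R]_n -> \bar R) :
  (average Q f * mu (cube Q) = \int[mu]_(x in cube Q) f x)%E.
Proof.
rewrite /average; have [m m0 ->] := cube_measure Q.
by rewrite inver gt_eqF// muleAC -EFinM mulVf ?mul1e// gt_eqF.
Qed.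

Variable g : 'rV[R]_n -> R.
Hypothesis mg : measurable_fun [set: Rn R n] (g : Rn R n -> R).

Lemma measurable_norm_EFin (D : set (Rn R n)) :
  measurable_fun D (fun x : Rn R n => `|g x|%:E).
Proof.
apply: measurable_funTS; apply/measurable_EFinP.
exact: (measurableT_comp (@normr_measurable R setT)).
Qed.

Lemma measurable_Phi0_norm l (D : set (Rn R n)) :
  measurable_fun D (fun x : Rn R n => (Phi0 (`|g x| / l))%:E).
Proof.
apply: measurable_funTS; apply/measurable_EFinP.
apply: (measurableT_comp measurable_Phi0); apply: measurable_funM.
  exact: (measurableT_comp (@normr_measurable R setT)).
exact: measurable_cst.
Qed.

(** The modular bounds the mean because [s <= Phi0 s]. *)
Lemma average_le_luxemburg Q :
  (average Q (fun x => `|g x|%:E) <= luxemburg Phi0 Q g)%E.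
Proof.
apply: le_ereal_inf_tmp => _ [l [l0 lQ] <-]; rewrite average_le.
have gl0 x : 0 <= `|g x| / l by rewrite divr_ge0// ltW.
move: lQ; rewrite average_le mul1e => lQ.
apply: le_trans (lee_wpmul2l _ lQ); last by rewrite lee_fin ltW.
have mPhi := @measurable_Phi0_norm l (cube Q).
rewrite -ge0_integralZl_EFin; last 4 first.
- exact: measurable_cube.
- by move=> x _; rewrite lee_fin Phi0_ge0.
- exact: mPhi.
- exact: ltW.
apply: ge0_le_integral.
- exact: measurable_cube.
- by move=> x _; rewrite lee_fin.
- exact: measurable_norm_EFin.
- by apply: emeasurable_funM; [exact: measurable_cst|exact: mPhi].
move=> x _; rewrite -EFinM lee_fin; apply: le_trans (ler_wpM2l (ltW l0) (Phi0_ge_id (gl0 x))).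
by rewrite mulrC divfK// gt_eqF.
Qed.

End orlicz.

Section local_estimate.
Context {R : realType} {n : nat}.
Local Notation mu := (@lebesgue_Rn R n).
Hypothesis unit_cube_gt0 : (0 < mu (@unit_cube R n))%E.
Variables (S : set (dcube n)) (eta : R) (E : dcube n -> set (Rn R n)).
Hypotheses (eta0 : 0 < eta) (eta1 : eta < 1).
Hypothesis SE : forall Q, S Q -> [/\ measurable (E Q), E Q `<=` cube Q &
  (eta%:E * mu (cube Q) <= mu (E Q))%E].
Hypothesis tE : trivIset S E.
Variable g : 'rV[R]_n -> R.
Hypothesis mg : measurable_fun [set: Rn R n] (g : Rn R n -> R).
Implicit Types (F : seq (dcube n)) (P Q : dcube n).

Lemma sum_integral_overlap F Q :
    (forall P, P \in F -> cube P `<=` (cube Q : set 'rV[R]_n)) ->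
  (\sum_(P <- F) \int[mu]_(x in cube P) `|g x|%:E =
   \int[mu]_(x in cube Q) (`|g x| * overlap F x)%:E)%E.
Proof.
move=> FQ.
under [RHS]eq_integral do rewrite /overlap mulr_sumr -sumEFin.
rewrite ge0_integral_sum; first last.
- by move=> P x _; rewrite lee_fin mulr_ge0.
- move=> P; apply/measurable_EFinP; apply: measurable_funM.
    exact/measurable_EFinP/measurable_norm_EFin.
  exact/measurable_indic/measurable_cube.
- exact: measurable_cube.
rewrite big_seq [RHS]big_seq; apply: eq_bigr => P /FQ PQ.
have PE : cube P = cube Q `&` cube P :> set (Rn R n) by rewrite setIC setIidl.
rewrite {1}PE integral_mkcondr; apply: eq_integral => x _.
by rewrite patchE indicE; case: (x \in cube P); rewrite ?mulr1 ?mulr0.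
Qed.

(** With [s = |g| / l] and [t = theta N], [N] the overlap function, Young's
    inequality bounds [|g| N] by [l / theta] times [Phi0 (|g| / l) + e^(theta N)];
    the integrals of the two terms over [Q] are at most [|Q|] and [2 |Q|], whence
    the constant [3 / theta = 12 / eta]. *)
Lemma sparse_sum_integral_le F Q l : 0 < l ->
    (average Q (fun x => (Phi0 (`|g x| / l))%:E) <= 1)%E ->
    sorted (fun P P' : dcube n => P.1 <= P'.1) F ->
    uniq F -> (forall P, P \in F -> S P) ->
    (forall P, P \in F -> cube P `<=` (cube Q : set 'rV[R]_n)) ->
  (\sum_(P <- F) \int[mu]_(x in cube P) `|g x|%:E <=
   (12 / eta * l)%:E * mu (cube Q))%E.
Proof.
move=> l0; rewrite average_le// mul1e => lQ sF uF FS FQ.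
rewrite (sum_integral_overlap FQ).
pose theta := eta / 4.
have theta0 : 0 < theta by rewrite divr_gt0.
have mPhi := @measurable_Phi0_norm R n g mg l (cube Q).
have mexp := @measurable_expR_overlap R n eta F (cube Q).
have c0 : 0 <= l / theta by rewrite divr_ge0// ltW.
have gl0 x : 0 <= `|g x| / l by rewrite divr_ge0// ltW.
apply: (@le_trans _ _ ((l / theta)%:E * \int[mu]_(x in cube Q)
   ((Phi0 (`|g x| / l))%:E + (expR (theta * overlap F x))%:E)))%E.
  rewrite -ge0_integralZl_EFin; last 4 first.
  - exact: measurable_cube.
  - by move=> x _; rewrite adde_ge0// lee_fin ?Phi0_ge0 ?expR_ge0.
  - exact: emeasurable_funD.
  - exact: c0.
  apply: ge0_le_integral.
  - exact: measurable_cube.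
  - by move=> x _; rewrite lee_fin mulr_ge0 ?overlap_ge0.
  - apply/measurable_EFinP; apply: measurable_funM.
      exact/measurable_EFinP/measurable_norm_EFin.
    exact/measurable_funTS/measurable_overlap.
  - apply: emeasurable_funM; first exact: measurable_cst.
    exact: emeasurable_funD.
  move=> x _; rewrite -EFinD -EFinM lee_fin.
  have := ler_wpM2l c0 (young_Phi0 (theta * overlap F x) (gl0 x)).
  apply: le_trans; rewrite le_eqVlt; apply/orP; left; apply/eqP.
  by field; rewrite gt_eqF// gt_eqF.
rewrite ge0_integralD; last 5 first.
- exact: measurable_cube.
- by move=> x _; rewrite lee_fin Phi0_ge0.
- exact: mPhi.
- by move=> x _; rewrite lee_fin expR_ge0.
- exact: mexp.
have := overlap_exp_integral eta0 eta1 SE tE sF uF FS FQ.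
have := sparse_packing SE tE uF FS FQ.
move=> Epack /le_trans/(_ (leeD2l _ Epack)) expQ.
apply: le_trans (lee_wpmul2l _ (leeD lQ expQ)) _; first by rewrite lee_fin.
have [m m0 ->] := cube_measure unit_cube_gt0 Q.
rewrite -!EFinD -!EFinM lee_fin le_eqVlt; apply/orP; left; apply/eqP.
by rewrite /theta; field; rewrite gt_eqF.
Qed.

Lemma sparse_esum_integral_le Q :
  (\esum_(P in S `&` [set P | cube P `<=` (cube Q : set 'rV[R]_n)])
     \int[mu]_(x in cube P) `|g x|%:E <=
   (12 / eta)%:E * mu (cube Q) * luxemburg Phi0 Q g)%E.
Proof.
have [m m0 Qm] := cube_measure unit_cube_gt0 Q.
have C0 : 0 < 12 / eta * m by rewrite mulr_gt0// divr_gt0.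
rewrite Qm -EFinM -lee_pdivrMl//; apply: le_ereal_inf_tmp => _ [l [l0 lQ] <-].
rewrite lee_pdivrMl//; apply: ge_ereal_sup => _ [A [finA AS] <-].
have /finite_seqP[s As] := finA.
pose F := sort (fun P P' : dcube n => P.1 <= P'.1) (undup s).
have uF : uniq F by rewrite sort_uniq undup_uniq.
have FA : A = [set` F].
  by rewrite As; apply/seteqP; split => P /=; rewrite mem_sort mem_undup.
rewrite FA -fsbig_seq//.
have {}AS P : P \in F -> (S `&` [set P | cube P `<=` (cube Q : set 'rV[R]_n)]) P.
  by move=> PF; apply: AS; rewrite FA.
apply: le_trans (sparse_sum_integral_le (Q := Q) l0 lQ _ _ _ _) _.
- by apply: sort_sorted => P P'; exact: le_total.
- exact: uF.
- by move=> P /AS[].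
- by move=> P /AS[].
by rewrite Qm -EFinM mulrAC.
Qed.

End local_estimate.

(** * The fractional maximal function dominates the sparse operator *)

Section geometric.
Context {R : realType}.
Local Open Scope ereal_scope.

Lemma nneseries_geometric_le (r : R) : (0 <= r < 1)%R ->
  \sum_(m <oo) (r ^+ m)%:E <= ((1 - r)^-1)%:E.
Proof.
move=> /andP[r0 r1]; apply: lime_le.
  by apply: is_cvg_nneseries => m _ _; rewrite lee_fin exprn_ge0.
apply: nearW => N; rewrite sumEFin lee_fin -[leRHS]mul1r ler_pdivlMr ?subr_gt0//.
have : ((\sum_(0 <= i < N) r ^+ i) * (1 - r) = 1 - r ^+ N)%R.
  elim: N => [|N IH]; first by rewrite big_nil mul0r expr0 subrr.
  by rewrite big_nat_recr//= mulrDl IH exprS; ring.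
by move=> ->; rewrite lerBlDr lerDl exprn_ge0.
Qed.

End geometric.

Section maximal_bound.
Context {R : realType} {n : nat}.
Local Notation mu := (@lebesgue_Rn R n).
Hypothesis unit_cube_gt0 : (0 < mu (@unit_cube R n))%E.
Variable g : 'rV[R]_n -> R.
Hypothesis mg : measurable_fun [set: Rn R n] (g : Rn R n -> R).
Variable alpha : R.
Hypothesis alpha0 : 0 < alpha.
Local Notation W := (orlicz_maximal alpha Phi0 g).
Local Notation avg P := (average P (fun x : 'rV[R]_n => `|g x|%:E)).
Implicit Types (P Q : dcube n) (x y : 'rV[R]_n).

Lemma average_ge0 P (f : 'rV[R]_n -> \bar R) : (forall x, 0 <= f x)%E ->
  (0 <= average P f)%E.
Proof.
move=> f0; apply: mule_ge0; last by apply: integral_ge0.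
by rewrite inve_ge0; exact: measure_ge0.
Qed.

Lemma luxemburg_ge0 P : (0 <= luxemburg Phi0 P g)%E.
Proof. by apply: le_ereal_inf_tmp => _ [l [l0 _] <-]; rewrite lee_fin ltW. Qed.

Lemma luxemburg_le_maximal P x : cube P x ->
  (luxemburg Phi0 P g <= (side P `^ (- alpha))%:E * W x)%E.
Proof.
move=> Px; have sP : 0 < side P `^ alpha by rewrite powR_gt0// side_gt0.
rewrite powRN -lee_pdivrMl ?invr_gt0// invrK; apply: ereal_sup_ubound.
by exists P => //; rewrite indicE mem_set// mule1.
Qed.

Lemma orlicz_maximal_ge0 x : (0 <= W x)%E.
Proof.
apply: le_ereal_sup_tmp; exists ((side (cube_at 0 x) `^ alpha)%:E *
  luxemburg Phi0 (cube_at 0 x) g * (\1_(cube (cube_at 0 x)) x)%:E)%E.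
  by exists (cube_at 0 x).
by rewrite mule_ge0 ?lee_fin// mule_ge0 ?lee_fin ?powR_ge0// luxemburg_ge0.
Qed.

Definition ancestor_constant : R := (1 - (2 : R) `^ (- alpha))^-1.

Lemma powR_alpha_lt1 : 0 <= (2 : R) `^ (- alpha) < 1.
Proof.
rewrite powR_ge0 /= powRN invf_lt1 ?powR_gt0//.
by rewrite /powR pnatr_eq0/= expR_gt1 mulr_gt0// ln_gt0// ltr1n.
Qed.

Lemma ancestor_constant_gt0 : 0 < ancestor_constant.
Proof. by rewrite invr_gt0 subr_gt0; case/andP: powR_alpha_lt1. Qed.

(** There is one cube through [x] at each level; at the level [m + 1] steps
    above [Q] the average of [|g|] is at most
    [(2^(m+1) l(Q))^(-alpha) W x]. *)
Lemma esum_ancestors_le Q x :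
  (\esum_(P in [set P : dcube n | cube P x /\ (P.1 < Q.1)%R]) avg P <=
   (ancestor_constant * side Q `^ (- alpha))%:E * W x)%E.
Proof.
have K0 : 0 < ancestor_constant * side Q `^ (- alpha).
  by rewrite mulr_gt0 ?ancestor_constant_gt0// powR_gt0// side_gt0.
have [w0|wy] : (W x \is a fin_num) \/ W x = +oo%E.
- by have := orlicz_maximal_ge0 x; case: (W x) => [r||]//; [left|right].
- pose e (m : nat) := cube_at (Q.1 - m.+1%:Z) x : dcube n.
  have -> : [set P : dcube n | cube P x /\ P.1 < Q.1] = e @` setT.
    apply/seteqP; split => [P /= [Px PQ]|_ [m _ <-] /=].
      exists `|(Q.1 - P.1 - 1)%R|%N => //; rewrite /e [RHS](cube_at_uniq Px).
      have lv (a b : int) : a < b -> b - (`|(b - a - 1)%R|%N.+1)%:Z = a by lia.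
      by congr cube_at; exact: lv.
    have lv (a : int) : a - m.+1%:Z < a by lia.
    by split; [exact: cube_at_mem|exact: lv].
  rewrite esum_image; last first.
    have lv (a : int) (m m' : nat) : a - m.+1%:Z = a - m'.+1%:Z -> m = m' by lia.
    by move=> m m' _ _ /(congr1 fst) /= /lv.
  rewrite -nneseries_esumT; last by move=> m; apply: average_ge0.
  apply: (@le_trans _ _ (\sum_(m <oo) ((side Q `^ (- alpha))%:E * W x *
      (((2 : R) `^ (- alpha)) ^+ m)%:E)))%E.
    apply: lee_nneseries => [m _ _|m _]; first exact: average_ge0.
    apply: le_trans (average_le_luxemburg unit_cube_gt0 mg _) _.
    apply: le_trans (luxemburg_le_maximal (cube_at_mem _ _)) _.
    rewrite muleAC; apply: lee_wpmul2r; first exact: orlicz_maximal_ge0.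
    rewrite -EFinM lee_fin.
    have -> : side (e m) = side Q * 2 ^+ m.+1 :> R.
      by rewrite /side /= opprB addrC expfzDr ?pnatr_eq0.
    rewrite powRM ?exprn_ge0 ?(ltW (side_gt0 _))// ler_wpM2l ?powR_ge0//.
    rewrite exprS powRM ?exprn_ge0// -[leRHS]mul1r.
    have -> : ((2 : R) ^+ m) `^ (- alpha) = (2 `^ (- alpha)) ^+ m.
      rewrite -(powR_mulrn m (ler0n R 2)) -(powR_mulrn m (powR_ge0 _ _)).
      by rewrite -2!powRrM mulrC.
    apply: ler_wpM2r; first by rewrite exprn_ge0 ?powR_ge0.
    by apply: ltW; case/andP: powR_alpha_lt1.
  rewrite -(fineK w0) -EFinM nneseriesZl; last first.
    by move=> m _; rewrite lee_fin exprn_ge0 ?powR_ge0.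
  rewrite [leRHS](_ : _ = (side Q `^ (- alpha) * fine (W x))%:E *
    ancestor_constant%:E)%E; last by rewrite -!EFinM; congr EFin; ring.
  apply: lee_wpmul2l; last exact: nneseries_geometric_le powR_alpha_lt1.
  by rewrite lee_fin mulr_ge0 ?powR_ge0// fine_ge0// orlicz_maximal_ge0.
by rewrite wy gt0_muley ?leey.
Qed.

End maximal_bound.

Section operator.
Context {R : realType} {n : nat}.
Local Notation mu := (@lebesgue_Rn R n).
Implicit Types (P Q : dcube n) (T : set (dcube n)) (f : 'rV[R]_n -> R).
Local Open Scope ereal_scope.

Lemma sparse_operator_ge0 T f x : (forall y, 0 <= f y)%R -> 0 <= sparse_operator T f x.
Proof.
move=> f0; apply: esum_ge0 => P _; rewrite mule_ge0 ?lee_fin//.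
by apply: average_ge0 => y; rewrite lee_fin.
Qed.

Lemma measurable_average_indic P f :
  measurable_fun [set: Rn R n] (fun x : Rn R n =>
    average P (EFin \o f) * (\1_(cube P : set (Rn R n)) x)%:E).
Proof.
apply: emeasurable_funM; first exact: measurable_cst.
exact/measurable_EFinP/measurable_indic/measurable_cube.
Qed.

Lemma average_indic_ge0 P f x : (forall y, 0 <= f y)%R ->
  0 <= average P (EFin \o f) * (\1_(cube P : set (Rn R n)) x)%:E.
Proof.
move=> f0; rewrite mule_ge0 ?lee_fin//.
by apply: average_ge0 => y; rewrite lee_fin.
Qed.

Lemma measurable_sparse_operator T f : (forall y, 0 <= f y)%R ->
  measurable_fun [set: Rn R n] (sparse_operator T f : Rn R n -> \bar R).
Proof.
move=> f0; apply: (@measurable_fun_esum _ _ _ (Rn R n)).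
- exact: countable_dcube.
- by move=> P _; exact: measurable_average_indic.
- by move=> P x; exact: average_indic_ge0.
Qed.

Lemma integral_sparse_operator T f : (0 < mu (@unit_cube R n)) ->
  (forall y, 0 <= f y)%R ->
  \int[mu]_x sparse_operator T f x =
  \esum_(P in T) \int[mu]_(x in cube P) (f x)%:E.
Proof.
move=> c0 f0; rewrite integral_esum; first last.
- by move=> P x; exact: average_indic_ge0.
- by move=> P _; exact: measurable_average_indic.
- exact: countable_dcube.
apply: eq_esum => P _; rewrite ge0_integralZl.
- rewrite integral_indic ?setIT; [exact: average_mul_measure| |exact: measurable_cube].
  exact: measurableT.
- exact: measurableT.
- exact/measurable_EFinP/measurable_indic/measurable_cube.
- by move=> x _; rewrite lee_fin.
- by apply: average_ge0 => y; rewrite lee_fin.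
Qed.
End operator.

Section maximal_domination.
Context {R : realType} {n : nat}.
Local Notation mu := (@lebesgue_Rn R n).
Hypothesis unit_cube_gt0 : (0 < mu (@unit_cube R n))%E.
Variables (S : set (dcube n)) (eta : R) (E : dcube n -> set (Rn R n)).
Hypotheses (eta0 : 0 < eta) (eta1 : eta < 1).
Hypothesis SE : forall Q, S Q -> [/\ measurable (E Q), E Q `<=` cube Q &
  (eta%:E * mu (cube Q) <= mu (E Q))%E].
Hypothesis tE : trivIset S E.
Variable g : 'rV[R]_n -> R.
Hypothesis mg : measurable_fun [set: Rn R n] (g : Rn R n -> R).
Variable d : R.
Hypothesis d_lt_n : d < n%:R.
Local Notation W := (orlicz_maximal (n%:R - d) Phi0 g).
Let absg y : R := `|g y|.
Local Notation h := (sparse_operator S absg).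
Implicit Types (P Q : dcube n) (x y : 'rV[R]_n).

Definition domination_constant : R :=
  fine (mu (@unit_cube R n)) * (12 / eta + ancestor_constant (n%:R - d)).

Let alpha0 : 0 < n%:R - d. Proof. by rewrite subr_gt0. Qed.

Lemma domination_constant_gt0 : 0 < domination_constant.
Proof.
rewrite mulr_gt0 ?addr_gt0 ?divr_gt0 ?ancestor_constant_gt0//.
by rewrite fine_gt0// unit_cube_gt0; exact: lebesgue_outer_unit_cube_lty.
Qed.

Let small Q : set (dcube n) := [set P | cube P `<=` (cube Q : set 'rV[R]_n)].

(** A cube of [S] that meets [Q] without being contained in it is an ancestor
    of [Q], hence contains every point [x] of [Q]: its contribution is constant on
    [Q] and can be estimated at [x]. *)
Lemma sparse_operator_le_small_big Q x y : cube Q x -> cube Q y ->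
  (h y <= sparse_operator (S `&` small Q) absg y +
    \esum_(P in [set P : dcube n | cube P x /\ (P.1 < Q.1)%R])
      average P (fun x => `|g x|%:E))%E.
Proof.
move=> Qx Qy; rewrite {1}/sparse_operator (esumID (small Q)); last first.
  by move=> P _; apply: average_indic_ge0 => z; exact: normr_ge0.
rewrite leeD2l// esum_mkcond [leRHS]esum_mkcond; apply: le_esum => P _.
have a0 : (0 <= average P (EFin \o absg))%E.
  by apply: average_ge0 => z; rewrite lee_fin normr_ge0.
case: ifPn => [|_]; last by case: ifP.
rewrite inE => -[_ /= PQ]; rewrite indicE.
have [|yP] := boolP (y \in cube P); last by rewrite mule0; case: ifP.
rewrite inE => Py; rewrite mule1 mem_set//=.
have lvl : P.1 < Q.1.
  by rewrite ltNge; apply/negP => QP; apply: PQ; exact: cube_nested Qy Py QP.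
by split=> //; apply: (cube_nested Py Qy (ltW lvl)).
Qed.

Lemma integral_sparse_operator_le Q x : cube Q x ->
  (\int[mu]_(y in cube Q) h y <=
   (domination_constant * side Q `^ d)%:E * W x)%E.
Proof.
move=> Qx; set B := (\esum_(P in [set P : dcube n | cube P x /\ (P.1 < Q.1)%R])
      average P (fun x => `|g x|%:E))%E.
have absg0 y : 0 <= absg y by exact: normr_ge0.
have mQ := @measurable_cube R n Q.
have B0 : (0 <= B)%E by apply: esum_ge0 => P _; apply: average_ge0 => y; rewrite lee_fin.
have mh := measurable_sparse_operator S absg0.
have mhQ := measurable_sparse_operator (S `&` small Q) absg0.
have hQ0 := fun y => sparse_operator_ge0 (S `&` small Q) y absg0.
apply: (@le_trans _ _ (\int[mu]_(y in cube Q)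
    (sparse_operator (S `&` small Q) absg y + cst B y)))%E.
  apply: ge0_le_integral.
  - exact: mQ.
  - by move=> y _; exact: sparse_operator_ge0.
  - exact: measurable_funTS mh.
  - by apply: emeasurable_funD; [exact: measurable_funTS mhQ|exact: measurable_cst].
  by move=> y Qy; exact: sparse_operator_le_small_big.
rewrite ge0_integralD; last 5 first.
- exact: mQ.
- by move=> y _; exact: hQ0.
- exact: measurable_funTS mhQ.
- by move=> y _; exact: B0.
- exact: measurable_cst.
rewrite integral_cst; last exact: mQ.
rewrite -[X in (_ + B * X)%E]/(lebesgue_Rn (cube Q)).
have small_le : (\int[mu]_(y in cube Q) sparse_operator (S `&` small Q) absg y <=
    (12 / eta)%:E * mu (cube Q) * luxemburg Phi0 Q g)%E.
  apply: le_trans (sparse_esum_integral_le unit_cube_gt0 eta0 eta1 SE tE mg Q).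
  rewrite -integral_sparse_operator//; apply: ge0_subset_integral => //.
have big_le := @esum_ancestors_le R n unit_cube_gt0 g mg _ alpha0 Q x.
have lux_le := @luxemburg_le_maximal R n g (n%:R - d) Q x Qx.
apply: le_trans (leeD small_le (lee_wpmul2r _ big_le)) _.
  exact: measure_ge0.
have c12 : (0 <= (12 / eta)%:E * mu (cube Q))%E.
  by rewrite mule_ge0 ?lee_fin ?divr_ge0 ?(ltW eta0)//; exact: measure_ge0.
apply: le_trans (leeD2r _ (lee_wpmul2l c12 lux_le)) _.
pose c := fine (mu (@unit_cube R n)).
have cE : mu unit_cube = c%:E.
  by rewrite fineK// ge0_fin_numE ?lebesgue_outer_unit_cube_lty// ltW.
have c0 : 0 <= c by rewrite fine_ge0// ltW.
have s0 : 0 <= side Q ^+ n * c by rewrite mulr_ge0 ?exprn_ge0 // ltW ?side_gt0.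
have -> : mu (cube Q) = (side Q ^+ n * c)%:E.
  by rewrite [LHS]lebesgue_outer_cube EFinM -cE.
have sideE : side Q ^+ n * side Q `^ (- (n%:R - d)) = side Q `^ d :> R.
  rewrite -powR_mulrn ?(ltW (side_gt0 _))// -powRD; last first.
    by rewrite (gt_eqF (side_gt0 _)) implybT.
  by rewrite opprB addrC subrK.
rewrite [X in (X + _)%E]muleA [X in (_ + X)%E]muleAC -!EFinM -ge0_muleDl; last 2 first.
- by rewrite lee_fin mulr_ge0 ?powR_ge0// mulr_ge0// divr_ge0// ltW.
- rewrite lee_fin mulr_ge0// mulr_ge0 ?powR_ge0//.
  exact/ltW/ancestor_constant_gt0.
rewrite -EFinD -sideE /domination_constant -/c le_eqVlt; apply/orP; left; apply/eqP.
by congr (_%:E * _)%E; ring.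
Qed.

End maximal_domination.

(** * A weight dominated by the Hausdorff content *)

Section measurable_sup.
Context {R : realType} d {X : measurableType d} {I : choiceType}.

Lemma measurable_fun_ereal_sup (F : I -> X -> \bar R) : countable [set: I] ->
  (forall i, measurable_fun [set: X] (F i)) ->
  measurable_fun [set: X] (fun x => ereal_sup [set F i x | i in [set: I]]).
Proof.
move=> cI mF; apply: (measurability _ (ErealGenOInfty.measurableE R)).
move=> _ [_ [a ->] <-]; rewrite setTI preimage_itvoy.
rewrite (_ : [set x | _] = \bigcup_i [set x | (a%:E < F i x)%E]).
  apply: countable_bigcupT_measurable => // i.
  by have := emeasurable_fun_o_infty measurableT (mF i) a%:E; rewrite setTI.
apply/seteqP; split => x /= => [/ereal_sup_gt[_ [i _ <-] aF]|[i _ aF]].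
  by exists i.
by apply: lt_le_trans aF _; apply: ereal_sup_ubound; exists i.
Qed.
End measurable_sup.

Section content_null.
Context {R : realType} {n : nat}.
Local Notation mu := (@lebesgue_Rn R n).
Variable d : R.
Hypotheses (d_gt0 : 0 < d) (d_le_n : d <= n%:R).

Lemma side_expn_le_powR (Q : dcube n) : side Q `^ d < 1 -> side Q ^+ n <= side Q `^ d :> R.
Proof.
move=> sd1; have s0 := @side_gt0 R n Q.
have s1 : side Q <= 1 :> R.
  rewrite leNgt; apply/negP => s1; move: sd1; rewrite ltNge => /negP; apply.
  have <- : 1 `^ d = 1 :> R by rewrite powR1.
  by apply: ge0_ler_powR; rewrite ?nnegrE ?(ltW s1) ?(ltW s0) ?(ltW d_gt0).
by rewrite -powR_mulrn ?(ltW s0)//; apply: ger_powR; rewrite ?s0.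
Qed.

(** In a cover with [sum l(Q)^d < 1] all sides are at most 1, so that
    [l(Q)^n <= l(Q)^d] as [d <= n]. *)
Lemma hausdorff_content_null (A : set 'rV[R]_n) : hausdorff_content d A = 0%E -> mu A = 0%E.
Proof.
move=> A0; pose c := fine (mu (@unit_cube R n)).
have c0 : 0 <= c by rewrite fine_ge0//; exact: measure_ge0.
have cE : mu unit_cube = c%:E.
  by rewrite fineK// ge0_fin_numE ?lebesgue_outer_unit_cube_lty//; exact: measure_ge0.
have le_eps e : 0 < e < 1 -> (mu A <= (c * e)%:E)%E.
  move=> /andP[e0 e1].
  have Af : hausdorff_content d A \is a fin_num by rewrite A0.
  have [_ [F [cF AF] <-]] := lb_ereal_inf_adherent e0 Af.
  rewrite [ereal_inf _]A0 add0e => Fe.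
  have Fi Q : F Q -> side Q ^+ n <= side Q `^ d :> R.
    move=> FQ; apply: side_expn_le_powR; rewrite -lte_fin.
    apply: le_lt_trans (lt_trans Fe _); last by rewrite lte_fin.
    apply: esum_ge; exists [set Q]; first by split => // _ ->.
    by rewrite fsbig_set1.
  apply: (@le_trans _ _ (\esum_(Q in F) mu (cube Q)))%E.
    exact: (outer_measure_cover_le (@lebesgue_outer R n) cF AF).
  apply: (@le_trans _ _ (\esum_(Q in F) (c%:E * (side Q `^ d)%:E)))%E.
    apply: le_esum => Q FQ; rewrite [mu _]lebesgue_outer_cube muleC -/(mu _) cE.
    by apply: lee_wpmul2l; rewrite ?lee_fin// Fi.
  rewrite esumZl//; last by move=> Q; rewrite lee_fin powR_ge0.
  by rewrite EFinM; apply: lee_wpmul2l; rewrite ?lee_fin// ltW.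
apply/eqP; rewrite eq_le [X in _ && X]measure_ge0 andbT.
apply/lee_addgt0Pr => e e0; rewrite add0e.
have c1 : 0 < c + 1 by rewrite ltr_wpDl.
(* [e' < 1] is needed for [le_eps], and [c + 1] avoids a division by [c = 0]. *)
pose e' := Num.min (1 / 2) (e / (c + 1)).
have e'0 : 0 < e' by rewrite lt_min !divr_gt0.
apply: le_trans (le_eps e' _) _.
  by rewrite e'0 /e' gt_min; apply/orP; left; lra.
rewrite lee_fin; apply: (@le_trans _ _ ((c + 1) * e')).
  by apply: ler_wpM2r; [exact: ltW|rewrite lerDl].
by rewrite mulrC -ler_pdivlMr// /e' ge_min lexx orbT.
Qed.

Lemma hausdorff_content_ge0 (A : set 'rV[R]_n) : (0 <= hausdorff_content d A)%E.
Proof. by apply: cover_content_ge0 => Q; exact: powR_ge0. Qed.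

Lemma le_hausdorff_content :
  {homo hausdorff_content (R := R) (n := n) d : A B / A `<=` B >-> (A <= B)%E}.
Proof. by move=> A B; exact: le_cover_content. Qed.

Lemma integral_le_hausdorff_content (v : 'rV[R]_n -> \bar R) (K : R) : 0 < K ->
    measurable_fun [set: Rn R n] (v : Rn R n -> \bar R) ->
    (forall x, 0 <= v x)%E ->
    (forall Q, \int[mu]_(x in cube Q) v x <= (K * side Q `^ d)%:E)%E ->
  forall A : set (Rn R n), measurable A ->
    (\int[mu]_(x in A) v x <= K%:E * hausdorff_content d A)%E.
Proof.
move=> K0 mv v0 vQ A mA; rewrite -lee_pdivrMl//.
apply: le_ereal_inf_tmp => _ [F [cF AF] <-]; rewrite lee_pdivrMl//.
have mF Q : F Q -> measurable (cube Q : set (Rn R n)) by move=> _; exact: measurable_cube.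
apply: le_trans (integral_cover_le mu cF mF mA AF mv v0) _.
rewrite -esumZl//; [|exact: ltW|by move=> Q; rewrite lee_fin powR_ge0].
by apply: le_esum => Q _; rewrite -EFinM.
Qed.

End content_null.

Section weight.
Context {R : realType} {n : nat}.
Local Notation mu := (@lebesgue_Rn R n).
Local Open Scope ereal_scope.

Lemma measurable_orlicz_maximal alpha (g : 'rV[R]_n -> R) :
  measurable_fun [set: Rn R n] (orlicz_maximal alpha Phi0 g : Rn R n -> \bar R).
Proof.
apply: (@measurable_fun_ereal_sup _ _ (Rn R n)); first exact: countable_dcube.
move=> Q; apply: emeasurable_funM; first exact: measurable_cst.
exact/measurable_EFinP/measurable_indic/measurable_cube.
Qed.

(** The quotient [h / W], with value 0 where [W] is 0 or [+oo]; the real power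
    [-1] is used because it is a measurable function on the whole line. *)
Definition quotient_weight (h W : 'rV[R]_n -> \bar R) (x : 'rV[R]_n) : \bar R :=
  h x * (fine (W x) `^ (-1))%:E.

Variables (h W : 'rV[R]_n -> \bar R).
Hypotheses (mh : measurable_fun [set: Rn R n] (h : Rn R n -> \bar R))
  (mW : measurable_fun [set: Rn R n] (W : Rn R n -> \bar R)).
Hypotheses (h0 : forall x, 0 <= h x) (W0 : forall x, 0 <= W x).

Lemma quotient_weight_ge0 x : 0 <= quotient_weight h W x.
Proof. by rewrite mule_ge0// lee_fin powR_ge0. Qed.

Lemma measurable_quotient_weight :
  measurable_fun [set: Rn R n] (quotient_weight h W : Rn R n -> \bar R).
Proof.
apply: emeasurable_funM; first exact: mh.
apply/measurable_EFinP.
apply: (measurableT_comp (@measurable_powR R (-1))).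
exact: (measurableT_comp (fine_measurable measurableT)).
Qed.

Lemma mul_quotient_weight x : W x < +oo -> (W x = 0 -> h x = 0) ->
  W x * quotient_weight h W x = h x.
Proof.
move=> Wy Wh0; have Wf : W x \is a fin_num by rewrite ge0_fin_numE.
have [Wx0|Wx0] := eqVneq (W x) 0; first by rewrite Wx0 mul0e Wh0.
rewrite /quotient_weight muleCA -{1}(fineK Wf) -EFinM powR_inv1 ?fine_ge0//.
by rewrite mulfV ?mule1// fine_eq0.
Qed.

(** If [J = \int_B h] is positive and finite then [W >= J / k] on [B], so that
    [h / W <= (k / J) h] there.  If [J = 0] then [h = 0] almost everywhere on
    [B]; if [J = +oo] then [W = +oo] on [B]. *)
Lemma integral_quotient_weight_le (B : set (Rn R n)) (k : R) : measurable B ->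
    (0 < k)%R -> (forall x, B x -> \int[mu]_(y in B) h y <= k%:E * W x) ->
  \int[mu]_(x in B) quotient_weight h W x <= k%:E.
Proof.
move=> mB k0 hW.
have mhB : measurable_fun B h by exact: measurable_funTS mh.
have mvB := measurable_funTS measurable_quotient_weight : measurable_fun B _.
have [I0|I0] := eqVneq (\int[mu]_(y in B) h y) 0.
  have hB0 : ae_eq mu B h (cst 0).
    apply/(ae_eq_integral_abs mu mB mhB); rewrite -[RHS]I0.
    by apply: eq_integral => x _; rewrite gee0_abs.
  rewrite (_ : \int[mu]_(x in B) _ = 0) ?lee_fin ?(ltW k0)//.
  rewrite -(integral0 mu B); apply: ge0_ae_eq_integral => //.
    by move=> x _; exact: quotient_weight_ge0.
  by apply: filterS hB0 => x /[apply] hx; rewrite /quotient_weight hx mul0e.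
have Ige0 : 0 <= \int[mu]_(y in B) h y by apply: integral_ge0.
have [Iy|Iy] := eqVneq (\int[mu]_(y in B) h y) +oo.
  rewrite integral0_eq ?lee_fin ?(ltW k0)// => x Bx.
  have := hW x Bx; rewrite Iy /quotient_weight; move: (W0 x).
  case: (W x) => [w _ |_ _|//] /=; last by rewrite powR0 ?mule0// oppr_eq0 oner_eq0.
  by rewrite leye_eq -EFinM.
have If : \int[mu]_(y in B) h y \is a fin_num by rewrite ge0_fin_numE// ltey.
pose J := fine (\int[mu]_(y in B) h y).
have J0 : (0 < J)%R by rewrite fine_gt0// lt0e I0 Ige0 ltey.
have kJ : (0 <= k / J)%R by rewrite divr_ge0 ?ltW.
apply: (@le_trans _ _ (\int[mu]_(x in B) ((k / J)%:E * h x))).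
  apply: ge0_le_integral.
  - exact: mB.
  - by move=> x _; exact: quotient_weight_ge0.
  - exact: mvB.
  - by apply: emeasurable_funM; [exact: measurable_cst|exact: mhB].
  move=> x Bx; rewrite /quotient_weight muleC; apply: lee_wpmul2r => //.
  have := hW x Bx; rewrite -(fineK If) -/J; move: (W0 x).
  case: (W x) => [w|_ _|//]; last first.
    by rewrite /= powR0 ?lee_fin// oppr_eq0 oner_eq0.
  rewrite -EFinM !lee_fin /= => w0 Jkw; rewrite powR_inv1//.
  have w_gt0 : (0 < w)%R by rewrite -(pmulr_rgt0 _ k0); exact: lt_le_trans Jkw.
  by rewrite ler_pdivlMr// mulrC ler_pdivrMr.
rewrite ge0_integralZl_EFin; [|exact: mB|by move=> x _; exact: h0|exact: mhB|exact: kJ].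
by rewrite -(fineK If) -EFinM -/J divfK// gt_eqF.
Qed.

End weight.

(** * Hoelder's inequality for the Choquet integral *)

Section choquet.
Context {R : realType} {n : nat}.
Local Notation mu := (@lebesgue_Rn R n).
Local Notation leb := (@lebesgue_measure R).
Local Open Scope ereal_scope.
Variable d : R.
Implicit Types (F G W : 'rV[R]_n -> \bar R).

Lemma measurable_content_level F : measurable_fun (`]0%R, +oo[%classic : set R)
  (fun t => hausdorff_content d [set x | t%:E < F x]).
Proof.
apply: nonincreasing_emeasurable => // s t st; apply: le_hausdorff_content => x /=.
by apply: le_lt_trans; rewrite lee_fin.
Qed.

Lemma le_choquet_integral F G : (forall x, F x <= G x) ->
  choquet_integral d F <= choquet_integral d G.
Proof.
move=> FG; apply: ge0_le_integral => //.
- by move=> t _; exact: hausdorff_content_ge0.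
- exact: measurable_content_level.
- exact: measurable_content_level.
move=> t _; apply: le_hausdorff_content => x /= /lt_le_trans; apply; exact: FG.
Qed.

Lemma choquet_norm_ge0 (p : \bar R) F : 0 <= choquet_norm d p F.
Proof.
case: p => [r||//]; first exact: poweR_ge0.
by apply: le_ereal_inf_tmp => _ [t [t0 _] <-]; rewrite lee_fin ltW.
Qed.

(** For finite [q] the integrand of the Choquet integral of [W^q] is at least
    the content of the set [W = +oo] for all [t > 0]. *)
Lemma content_pinfty_eq0 (q : \bar R) W : 0 < q -> (forall x, 0 <= W x) ->
  choquet_norm d q W < +oo -> hausdorff_content d [set x | W x = +oo] = 0.
Proof.
set Z := [set x | W x = +oo]; move=> + W0; case: q => [q|_|//].
  rewrite lte_fin => q0 /lty_poweRy; rewrite invr_eq0 gt_eqF// => /(_ isT) CIy.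
  apply/eqP/negPn/negP => Z0; move: CIy; rewrite ltNge => /negP; apply.
  apply: (@le_trans _ _ (\int[leb]_(t in `]0%R, +oo[) cst (hausdorff_content d Z) t)).
    rewrite integral_cst//= lebesgue_measure_itv/= ltry.
    by rewrite gt0_muley// lt0e Z0 hausdorff_content_ge0.
  apply: ge0_le_integral => //.
  - by move=> t _; exact: hausdorff_content_ge0.
  - exact: measurable_content_level.
  move=> t _; apply: le_hausdorff_content => x Zx /=; rewrite [W x]Zx.
  by rewrite gee0_abs// poweRyr ?ltry// gt_eqF.
move=> /ereal_inf_lt[_ [t [t0 tW] <-] _].
apply/eqP; rewrite eq_le hausdorff_content_ge0 andbT -tW.
by apply: le_hausdorff_content => x Zx /=; rewrite [W x]Zx gee0_abs// ltry.
Qed.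

End choquet.

Section young.
Context {R : realType}.
Local Open Scope ereal_scope.

(** Young's inequality for [b / a] and [w], with the factors [p^-1] and [q^-1]
    dropped; it is applied with [a] above the norm of [f] to make the estimate
    homogeneous. *)
Lemma scaled_young (p q a b : R) (w : \bar R) : (0 < p)%R -> (0 < q)%R ->
    (p^-1 + q^-1 = 1)%R -> (0 < a)%R -> (0 <= b)%R -> 0 <= w ->
  b%:E * w <= (a / a `^ p)%:E * (b `^ p)%:E + a%:E * w `^ q.
Proof.
move=> p0 q0 pq a0 b0.
have ap0 : (0 < a `^ p)%R by rewrite powR_gt0.
case: w => [w|_|//]; last first.
  by rewrite poweRyr ?gt_eqF// [a%:E * +oo]gt0_muley// addey ?leey// -EFinM.
rewrite poweR_EFin -!EFinM -EFinD !lee_fin => w0.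
have ba0 : (0 <= b / a)%R by rewrite divr_ge0 ?(ltW a0).
have bE : (b `^ p = (b / a) `^ p * a `^ p)%R.
  by rewrite -powRM ?(ltW a0)// divfK// gt_eqF.
have pV : (0 < p^-1)%R by rewrite invr_gt0.
have qV : (0 < q^-1)%R by rewrite invr_gt0.
have -> : (a / a `^ p * b `^ p = a * (b / a) `^ p)%R.
  by rewrite bE; field; rewrite !gt_eqF.
have -> : (b * w = a * (b / a * w))%R by field; rewrite gt_eqF.
rewrite -mulrDr ler_wpM2l ?(ltW a0)//.
apply: le_trans (conjugate_powR ba0 w0 p0 q0 pq) _; apply: lerD.
- by rewrite -[leRHS]mulr1 ler_wpM2l ?powR_ge0//; lra.
- by rewrite -[leRHS]mulr1 ler_wpM2l ?powR_ge0//; lra.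
Qed.

End young.

Section hoelder.
Context {R : realType} {n : nat}.
Local Notation mu := (@lebesgue_Rn R n).
Local Open Scope ereal_scope.
Variables (d K : R) (v W : 'rV[R]_n -> \bar R).
Hypotheses (d_gt0 : (0 < d)%R) (d_le_n : (d <= n%:R)%R) (K0 : (0 < K)%R).
Hypotheses (mv : measurable_fun [set: Rn R n] (v : Rn R n -> \bar R))
  (mW : measurable_fun [set: Rn R n] (W : Rn R n -> \bar R)).
Hypotheses (v0 : forall x, 0 <= v x) (W0 : forall x, 0 <= W x).
Hypothesis vH : forall A : set (Rn R n), measurable A ->
  \int[mu]_(x in A) v x <= K%:E * hausdorff_content d A.

Lemma integral_weight_le_choquet (F : 'rV[R]_n -> \bar R) :
  measurable_fun [set: Rn R n] (F : Rn R n -> \bar R) -> (forall x, 0 <= F x) ->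
  \int[mu]_x (F x * v x) <= K%:E * choquet_integral d F.
Proof.
move=> mF F0.

apply: (@layer_cake_le R _ (Rn R n) mu (hausdorff_content d) K F v).
- exact: ltW.
- by move=> A; exact: hausdorff_content_ge0.
- exact: le_hausdorff_content.
- exact: mF.
- exact: F0.
- exact: mv.
- exact: v0.
- exact: vH.
Qed.

Variables f : 'rV[R]_n -> R.
Hypotheses (mf : measurable_fun [set: Rn R n] (f : Rn R n -> R))
  (f0 : forall x, (0 <= f x)%R).

(** Some [t < 2] has [H^d (W > t) = 0], so [W <= 2] almost everywhere. *)
Lemma hoelder_choquet1 : choquet_norm d +oo W <= 1 ->
  \int[mu]_x ((f x)%:E * W x * v x) <=
    (2 * K)%:E * choquet_norm d 1%:E (EFin \o f).
Proof.
move=> W1; have /ereal_inf_lt[_ [t [t0 tW] <-] t2] : choquet_norm d +oo W < 2%:E.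
  by apply: le_lt_trans W1 _; rewrite lte_fin ltr1n.
pose A : set (Rn R n) := [set x | t%:E < W x].
have mA : measurable A.
  by have := emeasurable_fun_o_infty measurableT mW t%:E; rewrite setTI.
have A0 : mu A = 0.
  apply: (hausdorff_content_null d_gt0 d_le_n); rewrite -[RHS]tW.
  by congr (hausdorff_content d _); apply/funext => x; rewrite /A /= gee0_abs.
have mfv : measurable_fun [set: Rn R n] (fun x => (f x)%:E * v x).
  by apply: emeasurable_funM; [exact/measurable_EFinP|exact: mv].
have mfWv : measurable_fun [set: Rn R n] (fun x => (f x)%:E * W x * v x).
  apply: emeasurable_funM; last exact: mv.
  by apply: emeasurable_funM; [exact/measurable_EFinP|exact: mW].
have fv0 x : 0 <= (f x)%:E * v x by rewrite mule_ge0 ?lee_fin.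
apply: (@le_trans _ _ (\int[mu]_x (2%:E * ((f x)%:E * v x)))).
  apply: ae_ge0_le_integral.
  - exact: measurableT.
  - by move=> x _; rewrite mule_ge0// mule_ge0 ?lee_fin.
  - exact: mfWv.
  - by move=> x _; rewrite mule_ge0.
  - by apply: emeasurable_funM; [exact: measurable_cst|exact: mfv].
  exists A; split; [exact: mA|exact: A0|] => x /= /not_implyP[_ fWv].
  rewrite /A /= ltNge; apply/negP => Wt; apply: fWv.
  rewrite muleAC [leRHS]muleC; apply: lee_wpmul2l => //.
  by apply: le_trans Wt _; rewrite ltW.
rewrite ge0_integralZl_EFin; [|exact: measurableT|by move=> x _; exact: fv0|exact: mfv|by []].
rewrite EFinM -muleA; apply: lee_wpmul2l; first by rewrite lee_fin.
apply: le_trans (integral_weight_le_choquet _ _) _.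
- exact/measurable_EFinP.
- by move=> x; rewrite lee_fin.
apply: lee_wpmul2l; first by rewrite lee_fin ltW.
rewrite /choquet_norm invr1 poweRe1; last first.
  by apply: integral_ge0 => t' _; exact: hausdorff_content_ge0.
by apply: le_choquet_integral => x; rewrite poweRe1//= lee_fin ler_norm.
Qed.

Lemma hoelder_choquet p q : (0 < p)%R -> (0 < q)%R -> (p^-1 + q^-1 = 1)%R ->
    choquet_norm d q%:E W <= 1 ->
  \int[mu]_x ((f x)%:E * W x * v x) <=
    (2 * K)%:E * choquet_norm d p%:E (EFin \o f).
Proof.
move=> p0 q0 pq W1; set N := choquet_norm _ _ (EFin \o f).
pose CI F := @choquet_integral R n d F.
have CI_ge0 F : 0 <= CI F by apply: integral_ge0 => t _; exact: hausdorff_content_ge0.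
have root_le (r a : R) F : (0 < r)%R -> (0 <= a)%R ->
    CI F `^ r^-1 <= a%:E -> CI F <= (a `^ r)%:E.
  move=> r0 a0 Fa.
  have := @gt0_ler_poweR R r (ltW r0) _ _ _ _ Fa.
  rewrite -poweRrM mulVf ?gt_eqF// poweRe1// poweR_EFin; apply.
    by rewrite in_itv/= leey andbT poweR_ge0.
  by rewrite in_itv/= leey andbT lee_fin.
have CIW : CI (fun x => W x `^ q) <= 1.
  have := root_le q 1%R _ q0 ler01 W1; rewrite powR1.
  by apply: le_trans; apply: le_choquet_integral => x; rewrite gee0_abs.
(* The bound is proved with any [a > 0] above the norm [N], which may vanish. *)
have key (a : R) : (0 < a)%R -> N <= a%:E ->
    \int[mu]_x ((f x)%:E * W x * v x) <= (2 * K * a)%:E.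
  move=> a0 Na.
  have CIf : CI (fun x => (f x `^ p)%:E) <= (a `^ p)%:E.
    have := root_le p a _ p0 (ltW a0) Na.
    by apply: le_trans; apply: le_choquet_integral => x /=; rewrite ger0_norm.
  have ap0 : (0 < a `^ p)%R by rewrite powR_gt0.
  have b0 : (0 <= a / a `^ p)%R by rewrite divr_ge0 ?ltW.
  pose A (x : Rn R n) := (f x `^ p)%:E; pose B (x : Rn R n) := W x `^ q.
  have mA : measurable_fun [set: Rn R n] A.
    by apply/measurable_EFinP; apply: (measurableT_comp (@measurable_powR R p)).
  have mB : measurable_fun [set: Rn R n] B.
    exact: (measurableT_comp (measurable_poweR q)).
  have A0 x : 0 <= A x by rewrite lee_fin powR_ge0.
  have B0 x : 0 <= B x by exact: poweR_ge0.
  have mAv : measurable_fun [set: Rn R n] (fun x => A x * v x).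
    by apply: emeasurable_funM; [exact: mA|exact: mv].
  have mBv : measurable_fun [set: Rn R n] (fun x => B x * v x).
    by apply: emeasurable_funM; [exact: mB|exact: mv].
  have Av0 x : 0 <= A x * v x by rewrite mule_ge0.
  have Bv0 x : 0 <= B x * v x by rewrite mule_ge0.
  have mbAv : measurable_fun [set: Rn R n] (fun x => (a / a `^ p)%:E * (A x * v x)).
    by apply: emeasurable_funM; [exact: measurable_cst|exact: mAv].
  have maBv : measurable_fun [set: Rn R n] (fun x => a%:E * (B x * v x)).
    by apply: emeasurable_funM; [exact: measurable_cst|exact: mBv].
  apply: (@le_trans _ _ (\int[mu]_x ((a / a `^ p)%:E * (A x * v x) + a%:E * (B x * v x)))).
    apply: ge0_le_integral.
    - exact: measurableT.
    - by move=> x _; rewrite mule_ge0// mule_ge0 ?lee_fin.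
    - apply: emeasurable_funM; last exact: mv.
      by apply: emeasurable_funM; [exact/measurable_EFinP|exact: mW].
    - by apply: emeasurable_funD; [exact: mbAv|exact: maBv].
    move=> x _; rewrite !muleA -ge0_muleDl; last 2 first.
    - by apply: mule_ge0; [rewrite lee_fin|exact: A0].
    - by apply: mule_ge0; [rewrite lee_fin ltW|exact: B0].
    by apply: lee_wpmul2r => //; exact: scaled_young.
  rewrite ge0_integralD; [|exact: measurableT| | exact: mbAv| |exact: maBv]; last 2 first.
  - by move=> x _; apply: mule_ge0; [rewrite lee_fin|exact: Av0].
  - by move=> x _; apply: mule_ge0; [rewrite lee_fin ltW|exact: Bv0].
  rewrite ge0_integralZl_EFin;
    [|exact: measurableT|by move=> x _; exact: Av0|exact: mAv|exact: b0].
  rewrite ge0_integralZl_EFin;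
    [|exact: measurableT|by move=> x _; exact: Bv0|exact: mBv|exact: ltW].
  have IA : \int[mu]_x (A x * v x) <= (K * a `^ p)%:E.
    apply: le_trans (integral_weight_le_choquet mA A0) _.
    by rewrite EFinM; apply: lee_wpmul2l => //; rewrite lee_fin ltW.
  have IB : \int[mu]_x (B x * v x) <= K%:E.
    apply: le_trans (integral_weight_le_choquet mB B0) _.
    by rewrite -[leRHS]mule1; apply: lee_wpmul2l => //; rewrite lee_fin ltW.
  apply: le_trans (leeD (lee_wpmul2l _ IA) (lee_wpmul2l _ IB)) _.
  - by rewrite lee_fin.
  - by rewrite lee_fin ltW.
  rewrite -!EFinM -EFinD lee_fin le_eqVlt; apply/orP; left; apply/eqP.
  by field; rewrite gt_eqF.
have : 0 <= N by exact: choquet_norm_ge0.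
move: key; case: N => [r|_ _|//]; last by rewrite gt0_muley ?leey// lte_fin mulr_gt0.
move=> key; rewrite lee_fin => r0; apply/lee_addgt0Pr => e e0.
have K2 : (0 < 2 * K)%R by rewrite mulr_gt0.
have e2 : (0 < e / (2 * K))%R by rewrite divr_gt0.
apply: le_trans (key (r + e / (2 * K))%R _ _) _.
- by rewrite ltr_wpDl.
- by rewrite lee_fin lerDl ltW.
by rewrite -EFinM -EFinD lee_fin mulrDr [(2 * K * (e / _))%R]mulrC divfK// gt_eqF.
Qed.

End hoelder.

(** * Duality for the sparse operator *)

Section pairing.
Context {R : realType} {n : nat}.
Local Notation mu := (@lebesgue_Rn R n).
Local Open Scope ereal_scope.
Implicit Types (T : set (dcube n)) (f g : 'rV[R]_n -> R).

Lemma le_sparse_operator T (f1 f2 : 'rV[R]_n -> R) x :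
  (forall Q, \int[mu]_(y in cube Q) (f1 y)%:E <= \int[mu]_(y in cube Q) (f2 y)%:E) ->
  sparse_operator T f1 x <= sparse_operator T f2 x.
Proof.
move=> f12; apply: le_esum => Q _; apply: lee_wpmul2r; first by rewrite lee_fin.
apply: lee_wpmul2l; last exact: f12.
by rewrite inve_ge0; exact: measure_ge0.
Qed.

Lemma integral_sparse_operatorM T f g : (forall x, 0 <= f x)%R ->
    (forall x, 0 <= g x)%R -> measurable_fun [set: Rn R n] (g : Rn R n -> R) ->
  \int[mu]_x (sparse_operator T f x * (g x)%:E) =
  \esum_(Q in T) average Q (EFin \o f) * \int[mu]_(x in cube Q) (g x)%:E.
Proof.
move=> f0 g0 mg.
have mI Q : measurable_fun [set: Rn R n] (fun x : Rn R n =>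
    (g x)%:E * (average Q (EFin \o f) * (\1_(cube Q : set (Rn R n)) x)%:E)).
  by apply: emeasurable_funM; [exact/measurable_EFinP|exact: measurable_average_indic].
have I0 Q (x : Rn R n) :
    0 <= (g x)%:E * (average Q (EFin \o f) * (\1_(cube Q : set (Rn R n)) x)%:E).
  by apply: mule_ge0; [rewrite lee_fin|exact: average_indic_ge0].
transitivity (\int[mu]_x (\esum_(Q in T)
    ((g x)%:E * (average Q (EFin \o f) * (\1_(cube Q : set (Rn R n)) x)%:E)))).
  apply: eq_integral => x _; rewrite esumZl ?g0//; first by rewrite muleC.
    exact: countable_dcube.
  by move=> Q; exact: average_indic_ge0.
rewrite integral_esum; [|exact: countable_dcube|by move=> Q _; exact: mI|exact: I0].
apply: eq_esum => Q _.
have a0 : 0 <= average Q (EFin \o f) by apply: average_ge0 => y; rewrite lee_fin.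
transitivity (\int[mu]_x (average Q (EFin \o f) *
    ((g x)%:E * (\1_(cube Q : set (Rn R n)) x)%:E))).
  by apply: eq_integral => x _; rewrite muleCA.
rewrite ge0_integralZl; first last.
- exact: a0.
- by move=> x _; rewrite mule_ge0 ?lee_fin.
- apply: emeasurable_funM; apply/measurable_EFinP; first exact: mg.
  exact/measurable_indic/measurable_cube.
- exact: measurableT.
congr (_ * _); rewrite [RHS]integral_mkcond; apply: eq_integral => x _.
rewrite patchE indicE; case: (x \in cube Q); first by rewrite mule1.
by rewrite mule0.
Qed.

(** Both sides are the sum over [Q] of
    [|Q|^-1 (\int_Q f) (\int_Q g)]. *)
Lemma sparse_operator_adjoint T f g :
    (forall x, 0 <= f x)%R -> (forall x, 0 <= g x)%R ->
    measurable_fun [set: Rn R n] (f : Rn R n -> R) ->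
    measurable_fun [set: Rn R n] (g : Rn R n -> R) ->
  \int[mu]_x (sparse_operator T f x * (g x)%:E) =
  \int[mu]_x (sparse_operator T g x * (f x)%:E).
Proof.
move=> f0 g0 mf mg.
rewrite (integral_sparse_operatorM T f0 g0 mg) (integral_sparse_operatorM T g0 f0 mf).
by apply: eq_esum => Q _; rewrite /average muleAC.
Qed.

(** Every average that enters the left-hand side at [x] is at most a multiple of
    the maximal function at [x]. *)
Lemma sparse_operator_eq0 T g alpha x : (0 < mu (@unit_cube R n)) ->
  measurable_fun [set: Rn R n] (g : Rn R n -> R) ->
  orlicz_maximal alpha Phi0 g x = 0 -> sparse_operator T (fun y => `|g y|%R) x = 0.
Proof.
move=> c0 mg W0; apply: esum1 => Q _; rewrite indicE.
have [|_] := boolP (x \in cube Q); last by rewrite mule0.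
rewrite inE => Qx; rewrite mule1; apply/eqP; rewrite eq_le.
apply/andP; split; last by apply: average_ge0 => y; rewrite lee_fin.
apply: le_trans (average_le_luxemburg c0 mg Q) _.
by have := luxemburg_le_maximal g alpha Qx; rewrite W0 mule0.
Qed.

Lemma integral_unit_cube_null (F : 'rV[R]_n -> \bar R) : mu (@unit_cube R n) = 0 ->
  measurable_fun [set: Rn R n] (F : Rn R n -> \bar R) ->
  \int[mu]_x `|F x| = 0.
Proof.
move=> c0 mF; apply: integral_abs_eq0; [exact: measurableT|exact: mF|].
apply/eqP; rewrite eq_le [X in _ && X]measure_ge0 andbT.
have cT : [set: 'rV[R]_n] `<=` \bigcup_(Q in [set: dcube n]) cube Q.
  by move=> x _; exists (cube_at 0 x) => //; exact: cube_at_mem.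
apply: le_trans (outer_measure_cover_le (@lebesgue_outer R n) (countable_dcube _) cT) _.
rewrite esum1// => Q _; rewrite [LHS]lebesgue_outer_cube.
by rewrite [lebesgue_outer _]c0 mule0.
Qed.

End pairing.

Theorem theorem2p1 (R : realType) (n : nat) (d p : R) (S : set (dcube n))
    (n_ge1 : (1 <= n)%N) (d_gt0 : 0 < d) (d_lt_n : d < n%:R) (p_ge1 : 1 <= p)
    (S_sparse : sparse (R := R) S) :
  exists2 C : R, 0 < C &
    forall f : 'rV[R]_n -> R, choquet_space d p f -> (forall x, 0 <= f x) ->
      (orlicz_morrey_associate_norm d (hoelder_conjugate p%:E) Phi0
         (sparse_operator S f)
       <= C%:E * choquet_norm d p%:E (EFin \o f))%E.
Proof.
set mu := @lebesgue_Rn R n.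
(* If the unit cube is null then so is the whole space. *)
have [c0|c0] := eqVneq (mu (@unit_cube R n)) 0%E.
  exists 1 => // f _ f0; rewrite mul1e.
  apply: ge_ereal_sup => _ [g [[mg _] _] <-].
  rewrite integral_unit_cube_null; [exact: choquet_norm_ge0|exact: c0|].
  apply: emeasurable_funM; first exact: measurable_sparse_operator.
  exact/measurable_EFinP.
have {}c0 : (0 < mu (@unit_cube R n))%E by rewrite lt0e c0 measure_ge0.
have [eta /andP[eta0 eta1] [E [SE tE]]] := S_sparse.
pose K := @domination_constant R n eta d.
have K0 : 0 < K by exact: domination_constant_gt0.
exists (2 * K) => [|f _ f0]; first by rewrite mulr_gt0.
apply: ge_ereal_sup => _ [g [[mg _] gN] <-].
have mcube (Q : (int * 'rV[int]_n)%type) : measurable (cube Q : set (Rn R n)).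
  exact: measurable_cube.
(* [f1] is measurable, below [f], and keeps the integrals over dyadic cubes:
   it may replace [f] in the operator, and it has a smaller norm. *)
have [f1 [mf1 f1f f1_int]] := measurable_minorant mu mcube f0.
have f1_0 x : 0 <= f1 x by case/andP: (f1f x).
pose W := orlicz_maximal (n%:R - d) Phi0 g.
pose h := sparse_operator S (fun y : 'rV[R]_n => `|g y|).
have absg0 y : 0 <= `|g y| by exact: normr_ge0.
have mabsg : measurable_fun [set: Rn R n] (fun y : Rn R n => `|g y|).
  exact/measurable_EFinP/measurable_norm_EFin.
have W0 x : (0 <= W x)%E by exact: orlicz_maximal_ge0.
have mW : measurable_fun [set: Rn R n] (W : Rn R n -> \bar R).
  exact: measurable_orlicz_maximal.
have h0 x : (0 <= h x)%E by exact: sparse_operator_ge0.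
have mh : measurable_fun [set: Rn R n] (h : Rn R n -> \bar R).
  exact: measurable_sparse_operator.
pose v := quotient_weight h W.
have mv : measurable_fun [set: Rn R n] (v : Rn R n -> \bar R).
  exact: measurable_quotient_weight mh mW.
have v0 x : (0 <= v x)%E by exact: quotient_weight_ge0.
have vH : forall A : set (Rn R n), measurable A ->
    (\int[mu]_(x in A) v x <= K%:E * hausdorff_content d A)%E.
  apply: integral_le_hausdorff_content => // Q.
  apply: integral_quotient_weight_le => //.
    by rewrite mulr_gt0// powR_gt0// side_gt0.
  by move=> x Qx; apply: (integral_sparse_operator_le c0 eta0 eta1 SE tE mg d_lt_n).
pose q := hoelder_conjugate p%:E.
have p_gt0 : 0 < p by exact: lt_le_trans p_ge1.
have d_le_n := ltW d_lt_n.
have hoelder : (\int[mu]_x ((f1 x)%:E * W x * v x) <=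
    (2 * K)%:E * choquet_norm d p%:E (EFin \o f1))%E /\ (0 < q)%E.
  have [p1|p1] := eqVneq p 1.
    have qE : q = +oo%E by rewrite /q p1 hoelder_conjugate1.
    rewrite p1 qE; split => //.
    apply: (hoelder_choquet1 d_gt0 d_le_n K0 mv mW v0 W0 vH mf1 f1_0).
    by rewrite -qE.
  have p1_gt0 : 0 < p - 1 by rewrite subr_gt0 lt_def p1.
  have qE : q = (p / (p - 1))%:E.
    by rewrite /q /hoelder_conjugate /= eqe gt_eqF// -EFinB inver gt_eqF.
  have q0 : 0 < p / (p - 1) by rewrite divr_gt0.
  rewrite qE lte_fin; split => //.
  apply: (hoelder_choquet K0 mv mW v0 W0 vH mf1 f1_0 p_gt0 q0); last by rewrite -qE.
  by field; rewrite !gt_eqF.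
have [hoelder_le q0] := hoelder.
(* The norm of [W] is finite, so [W] is finite off a set of content zero, hence
   almost everywhere: there [h = W v]. *)
have Wy : hausdorff_content d [set x | W x = +oo%E] = 0%E.
  by apply: content_pinfty_eq0 q0 W0 _; apply: le_lt_trans gN _; rewrite ltry.
have muWy : mu [set x | W x = +oo%E] = 0%E by exact: hausdorff_content_null d_gt0 d_le_n _ Wy.
have mfh : measurable_fun [set: Rn R n] (fun x : Rn R n => h x * (f1 x)%:E)%E.
  by apply: emeasurable_funM; [exact: mh|exact/measurable_EFinP].
have mfWv : measurable_fun [set: Rn R n] (fun x : Rn R n => (f1 x)%:E * W x * v x)%E.
  apply: emeasurable_funM; last exact: mv.
  by apply: emeasurable_funM; [exact/measurable_EFinP|exact: mW].
apply: (@le_trans _ _ (\int[mu]_x (sparse_operator S f1 x * `|g x|%:E))%E).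
  apply: ge0_le_integral.
  - exact: measurableT.
  - by move=> x _; exact: abse_ge0.
  - apply: (measurableT_comp (@abse_measurable R setT)).
    apply: emeasurable_funM; first exact: measurable_sparse_operator.
    exact/measurable_EFinP.
  - apply: emeasurable_funM; first exact: measurable_sparse_operator.
    exact/measurable_EFinP.
  move=> x _; rewrite abseM gee0_abs; last exact: sparse_operator_ge0.
  apply: lee_wpmul2r; first by rewrite lee_fin.
  exact: le_sparse_operator f1_int.
rewrite (sparse_operator_adjoint S f1_0 absg0 mf1 mabsg).
apply: (@le_trans _ _ (\int[mu]_x ((f1 x)%:E * W x * v x))%E).
  apply: ae_ge0_le_integral.
  - exact: measurableT.
  - by move=> x _; apply: mule_ge0; [exact: h0|rewrite lee_fin].
  - exact: mfh.
  - by move=> x _; apply: mule_ge0; [apply: mule_ge0; rewrite ?lee_fin|exact: v0].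
  - exact: mfWv.
  exists [set x | W x = +oo%E]; split.
  - by have := mW measurableT [set +oo%E] (emeasurable_set1 _); rewrite setTI.
  - exact: muWy.
  move=> x /= /not_implyP[_ fWv]; apply: contrapT => /eqP Wx; apply: fWv.
  rewrite -muleA mul_quotient_weight ?ltey//; first by rewrite muleC.
  exact: sparse_operator_eq0 c0 mg.
apply: le_trans hoelder_le _; apply: lee_wpmul2l; first by rewrite lee_fin ltW// mulr_gt0.
apply: gt0_ler_poweR.
- by rewrite invr_ge0 ltW.
- by rewrite in_itv/= leey andbT; apply: integral_ge0 => t _; exact: hausdorff_content_ge0.
- by rewrite in_itv/= leey andbT; apply: integral_ge0 => t _; exact: hausdorff_content_ge0.
apply: le_choquet_integral => x /=; rewrite lee_fin.
by apply: ge0_ler_powR; rewrite ?nnegrE ?(ltW p_gt0)// !ger0_norm//; case/andP: (f1f x).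
Qed.
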